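(* Let $d\ge 2$, let $\gamma_1,\dots,\gamma_{d-1}:[0,1]\to\mathbb{R}$ be smooth functions such that the curve $$\Gamma=\{(s,\gamma_1(s),\dots,\gamma_{d-1}(s)):\ s\in[0,1]\}$$ has non-vanishing curvature and torsion, and let $$\phi_l(x,y)=(x_{l+1}-y_{l+1})-\gamma_l(x_1-y_1),\qquad 1\le l\le d-1 .$$ Let $E\subset\mathbb{R}^d$ be compact and Ahlfors-David regular with $\dim_{\mathcal H}(E)>d-\frac1d$. Then for every $t=(t_1,\dots,t_{d-1})\in\mathbb{R}^{d-1}$, $$\overline{\dim}_{\mathcal M}\{(x,y)\in E\times E:\ x_1-y_1\in[0,1],\ \phi_l(x,y)=t_l,\ 1\le l\le d-1\}\le 2\dim_{\mathcal H}(E)-(d-1).$$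
   Context: $\dim_{\mathcal H}$ is Hausdorff dimension and $\overline{\dim}_{\mathcal M}$ is upper Minkowski (box) dimension, with the convention that the empty set has upper Minkowski dimension $-\infty$. The functions $\phi_l$ are defined for pairs $(x,y)\in\mathbb{R}^d\times\mathbb{R}^d$ with $x_1-y_1\in[0,1]$. Non-vanishing curvature and torsion means that the parametrization $\Gamma(s)=(s,\gamma_1(s),\dots,\gamma_{d-1}(s))$ is non-degenerate: for every $s\in[0,1]$ the vectors $\Gamma'(s),\Gamma''(s),\dots,\Gamma^{(d)}(s)$ are linearly independent in $\mathbb{R}^d$. Ahlfors-David regular: $E$ is Ahlfors-David regular if there are a Borel measure $\mu$ supported on $E$ and a constant $C>0$ such that $C^{-1}\delta^{\alpha}\le\mu(B_\delta(x))\le C\delta^{\alpha}$ for all $x\in E$ and $0<\delta\le 1$, where $\alpha=\dim_{\mathcal H}(E)$ and $B_\delta(x)$ is the ball of radius $\delta$ centered at $x$. *)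

(* Defs.v *)
From HB Require Import structures.
From mathcomp Require Import all_boot all_order all_algebra.
From mathcomp Require Import all_classical all_reals all_analysis.

Set Implicit Arguments.
Unset Strict Implicit.
Unset Printing Implicit Defensive.

Import Order.TTheory GRing.Theory Num.Theory.
Import numFieldNormedType.Exports.

Local Open Scope classical_set_scope.
Local Open Scope ring_scope.

(* The library norm on 'rV[R]_n is the sup norm, hence the following. *)
Definition edist (R : realType) (n : nat) (x y : 'rV[R]_n) : R :=
  Num.sqrt (\sum_(i < n) (x 0 i - y 0 i) ^+ 2).

Definition eball (R : realType) (n : nat) (x : 'rV[R]_n) (r : R) :
  set 'rV[R]_n := [set y | edist x y < r].

(* -oo on the empty set *)
Definition ediam (R : realType) (n : nat) (U : set 'rV[R]_n) : \bar R :=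
  ereal_sup [set (edist x y)%:E | x in U & y in U].

(* The library has 0 `^ 0 = 1, so that points count 1 when s = 0; the empty set
   has to count 0 for every s. *)
Definition hausdorff_gauge (R : realType) (n : nat) (s : R)
  (U : set 'rV[R]_n) : \bar R :=
  if U == set0 then 0%E else (ediam U `^ s)%E.

Definition hausdorff_content (R : realType) (n : nat) (s delta : R)
  (A : set 'rV[R]_n) : \bar R :=
  ereal_inf [set (\sum_(0 <= i <oo) hausdorff_gauge s (U i))%E | U in
    [set U : (set 'rV[R]_n)^nat |
      A `<=` \bigcup_i U i /\ forall i, (ediam (U i) <= delta%:E)%E]].

Definition hausdorff_measure (R : realType) (n : nat) (s : R)
  (A : set 'rV[R]_n) : \bar R :=
  ereal_sup [set hausdorff_content s delta A | delta in [set d : R | 0 < d]].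

Definition hausdorff_dim (R : realType) (n : nat) (A : set 'rV[R]_n) : \bar R :=
  ereal_inf [set s%:E | s in
    [set s : R | 0 <= s /\ hausdorff_measure s A = 0%E]].

Definition covering_number (R : realType) (n : nat) (A : set 'rV[R]_n)
  (delta : R) : \bar R :=
  ereal_inf [set (size c)%:R%:E | c in
    [set c : seq 'rV[R]_n | A `<=` \bigcup_(x in [set` c]) eball x delta]].

(* Since lne 0 = -oo, the upper Minkowski dimension of the empty set is -oo. *)
Definition upper_minkowski_dim (R : realType) (n : nat) (A : set 'rV[R]_n) :
  \bar R :=
  limf_esup (fun delta : R =>
    (lne (covering_number A delta) / (ln delta^-1)%:E)%E) 0^'+.

Definition borel_rV (R : realType) (n : nat) :=
  g_sigma_algebraType (@open 'rV[R]_n).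

(* E is meant to be closed, so that a measure is supported on E exactly when it
   vanishes on the complement of E. *)
Definition ahlfors_david_regular (R : realType) (n : nat)
  (E : set 'rV[R]_n) : Prop :=
  exists (mu : {measure set (borel_rV R n) -> \bar R}) (alpha C : R),
    [/\ hausdorff_dim E = alpha%:E,
        mu (~` E) = 0%E,
        0 < C &
        forall (x : 'rV[R]_n) (delta : R), E x -> 0 < delta <= 1 ->
          ((C^-1 * delta `^ alpha)%:E <= mu (eball x delta)
             <= (C * delta `^ alpha)%:E)%E].

(* Derivative of a function on [0, 1], one-sided at the endpoints; only the
   values of f on [0, 1] matter. *)
Definition derive01 (R : realType) (V : normedModType R) (f : R -> V) (s : R) :
  V :=
  lim ((y - s)^-1 *: (f y - f s) @[y --> within `[0, 1] s^']).

Definition derivable01 (R : realType) (V : normedModType R) (f : R -> V)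
  (s : R) : Prop :=
  cvg ((y - s)^-1 *: (f y - f s) @[y --> within `[0, 1] s^']).

Definition derive01n (R : realType) (V : normedModType R) (k : nat)
  (f : R -> V) : R -> V :=
  iter k (@derive01 R V) f.

Definition smooth01 (R : realType) (V : normedModType R) (f : R -> V) : Prop :=
  forall (k : nat) (s : R), 0 <= s <= 1 -> derivable01 (derive01n k f) s.

(* In R^d with d = n.+1, coordinate 1 has index ord0 and coordinate l + 1, for
   1 <= l <= d - 1, has index lift ord0 l with l : 'I_n counted from 0. *)
Definition curve_param (R : realType) (n : nat) (gamma : 'I_n -> R -> R)
  (s : R) : 'rV[R]_n.+1 :=
  \row_(i < n.+1) if unlift ord0 i is Some l then gamma l s else s.

Definition nondegenerate_curve (R : realType) (d : nat)
  (G : R -> 'rV[R]_d) : Prop :=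
  forall s : R, 0 <= s <= 1 ->
    row_free (\matrix_(j < d) derive01n j.+1 G s).

Definition phi (R : realType) (n : nat) (gamma : 'I_n -> R -> R) (l : 'I_n)
  (x y : 'rV[R]_n.+1) : R :=
  (x 0 (lift ord0 l) - y 0 (lift ord0 l)) - gamma l (x 0 ord0 - y 0 ord0).

(* A pair (x, y) in R^d x R^d is encoded as the vector row_mx x y of R^(2 d). *)
Definition configuration_set (R : realType) (n : nat) (gamma : 'I_n -> R -> R)
  (E : set 'rV[R]_n.+1) (t : 'rV[R]_n) : set 'rV[R]_(n.+1 + n.+1) :=
  [set row_mx xy.1 xy.2 | xy in
    [set xy : 'rV[R]_n.+1 * 'rV[R]_n.+1 |
      [/\ E xy.1, E xy.2,
          0 <= xy.1 0 ord0 - xy.2 0 ord0 <= 1 &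
          forall l : 'I_n, phi gamma l xy.1 xy.2 = t 0 l]]].

(* Main.v *)
(* Let P be a maximal delta-separated subset of E, with delta ~ 1/N and N = 2 ^ J. By Ahlfors-David
   regularity, covering the configuration set at scale delta reduces to counting the pairs (p, q)
   in P x P with p - q within O(delta) of the translated curve. That count is bounded by integrating
   F_N(p - q - (0, t) - Gamma(s)) over s, where F_N(u) = |sum_{a in [0, N)^d} exp(i a.u)|^2 is an
   unnormalised Fejer kernel, at least (N/2)^(2d) for |u| <= 1/N. Expanding F_N, the double sum over
   P x P becomes sum_{a, b} H(a - b) int cos((a - b).((0, t) + Gamma(s))) ds with the positive
   weights H(m) = |sum_{p in P} exp(i m.p)|^2. Non-degeneracy and van der Corput's lemma bound the
   integral by |a - b|^(-1/d). On the shell |a - b| ~ 2 ^ j the sum of H is compared with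
   sum_{p, q} F_{2^(j+1)}(p - q), which regularity controls by counting points of P in cells of side
   2 ^ -j. The shells contribute a geometric series of ratio 2 ^ (d - 1/d - dim E) < 1. Integrals
   enter only through values of antiderivatives, compared by the mean value theorem. *)
Require Import Defs.
From mathcomp Require Import all_boot all_order all_algebra.
From mathcomp Require Import all_classical all_reals all_analysis.
From mathcomp Require Import zify ring lra.
From mathcomp Require Import perm complex.
Set Implicit Arguments.
Unset Strict Implicit.
Unset Printing Implicit Defensive.

Import Order.TTheory GRing.Theory Num.Theory.
Import numFieldNormedType.Exports.
Local Open Scope classical_set_scope.
Local Open Scope ring_scope.

(** * Antiderivatives on a segment *)

(** Positivity makes the kernel usable twice. In space, F_N >= 0 allows the pairs that are not
    counted, and all s outside a short interval, to be discarded. In frequency, H >= 0 allows each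
    integral to be replaced by its absolute value and each shell by the full ball containing it,
    whose sum of H is controlled by kernels again. The price is periodicity: F_N is large near every
    point of 2 pi Z^d, so the points are rescaled by a constant [kappa] that brings all coordinates
    of p - q into [-1, 1].

    The exponent arises as follows. With |P| at most of order N^alpha, alpha = dim E, every shell
    contributes at most a constant times N^(d + 2 alpha) times the j-th power of the ratio. Each
    counted pair contributes at least a constant times N^(2 d - 1), since s stays good on an
    interval of length about 1/N. The quotient is N^(2 alpha - (d - 1)).

    [antideriv] asks for a derivative inside the segment and continuity up to its ends, as the mean
    value theorem does; the curve has only one-sided derivatives at 0 and 1. *)

Definition antideriv (R : realType) (a b : R) (F f : R -> R) : Prop :=
  (forall x, a < x < b -> is_derive x (1 : R) F (f x)) /\
  (forall x, a <= x <= b -> F y @[y --> within `[a, b] (nbhs x)] --> F x).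

Section Antiderivatives.
Context (R : realType).
Implicit Types (a b : R) (F G f g : R -> R).

Lemma antideriv_sub a b a' b' F f : a <= a' -> b' <= b ->
  antideriv a b F f -> antideriv a' b' F f.
Proof.
move=> aa bb [dF cF]; split=> x /andP[x1 x2].
  by apply: dF; rewrite (le_lt_trans aa)// (lt_le_trans x2).
apply: cvg_trans (cF x _); last by rewrite (le_trans aa)// (le_trans x2).
apply: cvg_app; apply: within_subset.
move=> y /=; rewrite !in_itv/= => /andP[y1 y2].
by rewrite (le_trans aa)// (le_trans y2).
Qed.

Lemma antiderivN a b F f : antideriv a b F f ->
  antideriv a b (fun x => - F x) (fun x => - f x).
Proof.
move=> [dF cF]; split=> [x xab|x xab].
  by have := dF x xab; exact: is_deriveN.
by apply: cvgN; exact: cF.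
Qed.

Lemma antiderivD a b F f G g : antideriv a b F f -> antideriv a b G g ->
  antideriv a b (fun x => F x + G x) (fun x => f x + g x).
Proof.
move=> [dF cF] [dG cG]; split=> [x xab|x xab].
  by have dFx := dF x xab; have dGx := dG x xab; exact: is_deriveD.
by apply: cvgD; [exact: cF|exact: cG].
Qed.

Lemma antideriv_cst a b (c : R) : antideriv a b (fun=> c) (fun=> 0).
Proof. by split=> [x xab|x xab]; [exact: is_derive_cst|exact: cvg_cst]. Qed.

Lemma antideriv_id a b : antideriv a b id (fun=> 1).
Proof.
split=> [x xab|x xab]; first exact: is_derive_id.
exact: cvg_within.
Qed.

Lemma antiderivM a b F f G g : antideriv a b F f -> antideriv a b G g ->
  antideriv a b (fun x => F x * G x) (fun x => f x * G x + F x * g x).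
Proof.
move=> [dF cF] [dG cG]; split=> [x xab|x xab].
  have dFx := dF x xab; have dGx := dG x xab.
  by apply: is_derive_eq; rewrite addrC /GRing.scale/= mulrC.
by apply: cvgM; [exact: cF|exact: cG].
Qed.

Lemma antiderivZ a b F f (c : R) : antideriv a b F f ->
  antideriv a b (fun x => c * F x) (fun x => c * f x).
Proof.
move=> [dF cF]; split=> [x xab|x xab].
  by have dFx := dF x xab; exact: is_deriveZ.
by apply: cvgM; [exact: cvg_cst|exact: cF].
Qed.

Lemma antideriv_sum a b (I : Type) (r : seq I) (P : pred I) (F f : I -> R -> R) :
  (forall i, P i -> antideriv a b (F i) (f i)) ->
  antideriv a b (fun x => \sum_(i <- r | P i) F i x)
                (fun x => \sum_(i <- r | P i) f i x).
Proof.
move=> H; elim: r => [|i r IH].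
  rewrite (_ : (fun x => _) = fun=> 0); last by apply/funext => x; rewrite big_nil.
  rewrite [X in antideriv _ _ _ X](_ : _ = fun=> 0).
    exact: antideriv_cst.
  by apply/funext => x; rewrite big_nil.
rewrite (_ : (fun x => \sum_(j <- i :: r | P j) F j x) =
  if P i then fun x => F i x + \sum_(j <- r | P j) F j x
  else fun x => \sum_(j <- r | P j) F j x); last first.
  by case: ifP => Pi; apply/funext => x; rewrite big_cons Pi.
rewrite (_ : (fun x => \sum_(j <- i :: r | P j) f j x) =
  if P i then fun x => f i x + \sum_(j <- r | P j) f j x
  else fun x => \sum_(j <- r | P j) f j x); last first.
  by case: ifP => Pi; apply/funext => x; rewrite big_cons Pi.
by case: ifP => // Pi; apply: antiderivD; first exact: H.
Qed.

Lemma antideriv_comp a b F f (h h' : R -> R) :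
  (forall x : R, is_derive x (1 : R) h (h' x)) -> antideriv a b F f ->
  antideriv a b (fun x => h (F x)) (fun x => h' (F x) * f x).
Proof.
move=> dh [dF cF]; split=> [x xab|x xab].
  have dFx := dF x xab.
  by have dhx := dh (F x); exact: (@is_derive1_comp R h F).
have hc : {for F x, continuous h}.
  apply: differentiable_continuous; apply/derivable1_diffP.
  by have [] := dh (F x).
by apply: (@cvg_comp _ _ _ F h _ _ _ _ hc); exact: cF.
Qed.

Lemma antiderivV a b F f : (forall x, a <= x <= b -> F x != 0) ->
  antideriv a b F f -> antideriv a b (fun x => (F x)^-1) (fun x => - (f x / F x ^+ 2)).
Proof.
move=> F0 [dF cF]; split=> [x xab|x xab].
  have Fx0 : F x != 0 by apply: F0; move/andP: xab => [/ltW -> /ltW ->].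
  apply: is_derive_eq; first exact: (@is_deriveV _ F x (f x) 1 Fx0 (dF x xab)).
  by rewrite /GRing.scale/= mulrC mulrN.
by apply: cvgV; [exact: F0|exact: cF].
Qed.

Lemma antideriv_le a b F f G g : a <= b -> antideriv a b F f -> antideriv a b G g ->
  (forall x, a < x < b -> f x <= g x) -> F b - F a <= G b - G a.
Proof.
rewrite le_eqVlt => /orP[/eqP->|ab]; first by rewrite !subrr.
move=> /antiderivN AF AG fg; have [dH cH] := antiderivD AG AF.
have dH' x : x \in `]a, b[ -> is_derive x 1 (fun x => G x + - F x) (g x + - f x).
  by rewrite in_itv/=; exact: dH.
have cH' : {within `[a, b], continuous (fun x => G x + - F x)}.
  by apply/subspace_continuousP => x /=; rewrite in_itv/=; exact: cH.
have [c] := MVT ab dH' cH'; rewrite in_itv/= => cab.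
have := fg c cab; rewrite -subr_ge0 => fgc e.
have : 0 <= (g c - f c) * (b - a) by rewrite mulr_ge0// subr_ge0 ltW.
by rewrite -e; lra.
Qed.

Lemma antideriv_norm_le a b F f G g : a <= b ->
  antideriv a b F f -> antideriv a b G g ->
  (forall x, a < x < b -> `|f x| <= g x) -> `|F b - F a| <= G b - G a.
Proof.
move=> ab AF AG fg; rewrite ler_norml; apply/andP; split.
  suff : - F b - - F a <= G b - G a by lra.
  apply: antideriv_le ab (antiderivN AF) AG _ => x xab.
  by have := fg x xab; rewrite ler_norml; lra.
apply: antideriv_le ab AF AG _ => x xab.
by have := fg x xab; rewrite ler_norml; lra.
Qed.

Lemma antideriv_norm_lecst a b F f (K : R) : a <= b -> antideriv a b F f ->
  (forall x, a < x < b -> `|f x| <= K) -> `|F b - F a| <= K * (b - a).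
Proof.
move=> ab AF fK; rewrite mulrBr.
apply: (antideriv_norm_le ab AF (antiderivZ K (antideriv_id a b))) => x xab.
by rewrite mulr1; exact: fK.
Qed.

Lemma antideriv_lipschitz a b F f (K : R) : antideriv a b F f ->
  (forall x, a <= x <= b -> `|f x| <= K) ->
  forall x y, a <= x <= b -> a <= y <= b -> `|F x - F y| <= K * `|x - y|.
Proof.
move=> dF fK x y; wlog yx : x y / y <= x.
  move=> H xab yab; have [yx|/ltW xy] := leP y x; first exact: H.
  by rewrite distrC [`|x - y|]distrC; exact: H.
move=> /andP[ax xb] /andP[ay yb]; rewrite [`|x - y|]ger0_norm ?subr_ge0//.
apply: (antideriv_norm_lecst yx (antideriv_sub ay xb dF)) => z /andP[yz zx].
by apply: fK; rewrite (le_trans ay (ltW yz)) (le_trans (ltW zx) xb).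
Qed.

Lemma antideriv_exists f : continuous f ->
  exists F, forall a b, 0 <= a -> b <= 1 -> antideriv a b F f.
Proof.
move=> cf.
(* The base point -1 and the larger segment up to 2 put [0, 1] in the interior, so that the
   derivative is two-sided even at 0 and 1. *)
exists (fun x => \int[lebesgue_measure]_(t in `[-1, x]) f t)%R => a b a0 b1.
have d (x : R) : 0 <= x <= 1 ->
  is_derive x (1 : R) (fun x : R => \int[lebesgue_measure]_(t in `[-1, x]) f t)%R (f x).
  move=> /andP[x0 x1].
  have [] := @continuous_FTC1_closed R f (-1) x 2.
  - lra.
  - apply: continuous_compact_integrable; first exact: segment_compact.
    exact: continuous_subspaceT.
  - by lra.
  - exact: cf.
  by move=> dF; rewrite derive1E => F'; exact: DeriveDef.
split=> x /andP[x0 x1]; first by apply: d; lra.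
have dx : is_derive x 1 (fun x : R => \int[lebesgue_measure]_(t in `[-1, x]) f t)%R (f x).
  by apply: d; lra.
apply: cvg_within_filter; apply: (@differentiable_continuous _ _ _ x).
by apply/derivable1_diffP; have [] := dx.
Qed.

End Antiderivatives.

(** * Van der Corput's lemma *)

Section VanDerCorput.
Context (R : realType).
Implicit Types (a b rho : R) (p : nat -> R -> R) (S T : R -> R).

(* Integration by parts without an integral: S - sin p0 / p1 has derivative
   sin p0 * p2 / p1 ^ 2. *)
Lemma oscillation_le a b (p0 p1 p2 : R -> R) rho S T (T' : R -> R) :
  a <= b -> 0 < rho ->
  antideriv a b p0 p1 -> antideriv a b p1 p2 ->
  (forall x, a <= x <= b -> rho <= p1 x) ->
  antideriv a b T T' -> (forall x, a < x < b -> `|p2 x| <= T' x * p1 x ^+ 2) ->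
  antideriv a b S (fun x => cos (p0 x)) ->
  `|S b - S a| <= 2 / rho + (T b - T a).
Proof.
move=> ab rho0 d0 d1 p1rho dT p2T dS.
have p1_gt0 x : a <= x <= b -> 0 < p1 x by move=> /p1rho; exact: lt_le_trans.
have d2 := antiderivV (fun x xab => lt0r_neq0 (p1_gt0 x xab)) d1.
have dsin := antideriv_comp (@is_derive_sin R) d0.
have dU := antiderivD dS (antiderivN (antiderivM dsin d2)).
have H : `|(S b + - (sin (p0 b) * (p1 b)^-1)) - (S a + - (sin (p0 a) * (p1 a)^-1))|
    <= T b - T a.
  apply: (antideriv_norm_le ab dU dT) => x xab.
  have p1x : 0 < p1 x by apply: p1_gt0; move/andP: xab => [/ltW -> /ltW ->].
  rewrite [X in `|X|](_ : _ = sin (p0 x) * (p2 x / p1 x ^+ 2)); last first.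
    by field; exact: lt0r_neq0.
  rewrite normrM normrM normfV (ger0_norm (sqr_ge0 _)).
  apply: (@le_trans _ _ (1 * (`|p2 x| / p1 x ^+ 2))).
    by rewrite ler_wpM2r ?sin_max// divr_ge0// sqr_ge0.
  by rewrite mul1r ler_pdivrMr ?exprn_gt0// p2T.
have E x : a <= x <= b -> `|sin (p0 x) * (p1 x)^-1| <= rho^-1.
  move=> xab; rewrite normrM normfV (gtr0_norm (p1_gt0 x xab)) -[leRHS]mul1r.
  rewrite ler_pM ?sin_max// ?invr_ge0 ?(ltW (p1_gt0 x xab))//.
  by rewrite lef_pV2 ?posrE ?p1_gt0// p1rho.
have Ea : `|sin (p0 a) * (p1 a)^-1| <= rho^-1 by apply: E; rewrite lexx.
have Eb : `|sin (p0 b) * (p1 b)^-1| <= rho^-1 by apply: E; rewrite lexx andbT.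
move: H Ea Eb; rewrite !ler_norml; lra.
Qed.

Lemma cos_antideriv_le a b (p : R -> R) S : a <= b ->
  antideriv a b S (fun x => cos (p x)) -> `|S b - S a| <= b - a.
Proof.
move=> ab dS; rewrite -[leRHS]mul1r.
by apply: (antideriv_norm_lecst ab dS) => x _; exact: cos_max.
Qed.

Lemma antideriv_ge_growth a b (F f : R -> R) (l : R) :
  antideriv a b F f -> (forall x, a <= x <= b -> l <= f x) ->
  forall x y, a <= x -> x <= y -> y <= b -> l * (y - x) <= F y - F x.
Proof.
move=> dF fl x y ax xy yb.
have dF' := antideriv_sub ax yb dF.
rewrite mulrBr.
apply: (antideriv_le xy (antiderivZ l (antideriv_id x y)) dF') => z /andP[z1 z2].
by rewrite mulr1 fl// (le_trans ax (ltW z1)) (le_trans (ltW z2) yb).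
Qed.

(* c is the zero of F if there is one, and an endpoint otherwise. *)
Lemma growth_zero a b (F f : R -> R) (l : R) : a <= b -> 0 <= l ->
  antideriv a b F f -> (forall x, a <= x <= b -> l <= f x) ->
  exists c, [/\ a <= c, c <= b,
    forall x, a <= x -> x < c -> F x <= - (l * (c - x)) &
    forall x, c < x -> x <= b -> l * (x - c) <= F x].
Proof.
move=> ab l0 dF fl; have gr := antideriv_ge_growth dF fl.
have [Fa|Fa] := leP 0 (F a).
  exists a; split => // x ax; first by move=> /(le_lt_trans ax); rewrite ltxx.
  by move=> xb; have := gr a x (lexx _) (ltW ax) xb; lra.
have [Fb|Fb] := leP (F b) 0.
  exists b; split => // x ax xb; first by have := gr x b ax (ltW xb) (lexx _); lra.
  by have := lt_le_trans ax xb; rewrite ltxx.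
have cF : {within `[a, b], continuous F}.
  by apply/subspace_continuousP => x /=; rewrite in_itv/=; exact: dF.2.
have [] := @IVT R F a b 0 ab cF.
  by rewrite ge_min le_max (ltW Fa) (ltW Fb) orbT.
move=> c; rewrite in_itv/= => /andP[ac cb] Fc; exists c; split => // x ax xc.
  by have := gr x c ax (ltW xc) cb; lra.
by have := gr c x ac (ltW ax) xc; lra.
Qed.

(** Induction on the order of the derivative. Since that derivative is at least a power of [rho],
    the one below it exceeds the next lower power in absolute value at distance [1 / rho] from the
    point [c] of [growth_zero]. The trivial bound costs [1 / rho] on each side of [c], so the
    constants obey C_0 = 3 and C_(k+1) = 2 C_k + 2, whence [5 * 2 ^+ k - 2]. The sign condition on
    [p 2] is the monotonicity of [p 1] that order one requires. *)
Lemma van_der_corput k a b p rho S :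
  a <= b -> 0 < rho ->
  (forall j, (j <= k.+1)%N -> antideriv a b (p j) (p j.+1)) ->
  (forall x, a <= x <= b -> rho ^+ k.+1 <= p k.+1 x) ->
  (k = 0%N -> (forall x, a <= x <= b -> 0 <= p 2 x) \/
              (forall x, a <= x <= b -> p 2 x <= 0)) ->
  antideriv a b S (fun x => cos (p 0%N x)) ->
  `|S b - S a| <= (5 * 2 ^+ k - 2) / rho.
Proof.
elim: k a b p S => [|k IH] a b p S ab rho0 dp prho psgn dS.
  have p1_gt0 x : a <= x <= b -> 0 < p 1%N x.
    by move=> /prho; rewrite expr1; exact: lt_le_trans.
  have d0 := dp 0%N isT; have d1 := dp 1%N isT.
  have dT := antiderivV (fun x xab => lt0r_neq0 (p1_gt0 x xab)) d1.
  have prho' x : a <= x <= b -> rho <= p 1%N x by move=> /prho; rewrite expr1.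
  have E x : a <= x <= b -> 0 <= (p 1%N x)^-1 <= rho^-1.
    move=> xab; rewrite invr_ge0 (ltW (p1_gt0 x xab)).
    by rewrite lef_pV2 ?posrE ?p1_gt0// prho'.
  have Ea : 0 <= (p 1%N a)^-1 <= rho^-1 by apply: E; rewrite lexx.
  have Eb : 0 <= (p 1%N b)^-1 <= rho^-1 by apply: E; rewrite lexx andbT.
  rewrite expr0 mulr1 (_ : 5 - 2 = 3); last by ring.
  (* As [p 2] keeps its sign, [1 / p 1] is monotone and varies by at most [1 / rho]; the majorant in
     [oscillation_le] is this function or its opposite. *)
  have [psg|psg] := psgn erefl.
    have := oscillation_le ab rho0 d0 d1 prho' (antiderivN dT) _ dS.
    suff H x : a < x < b -> `|p 2 x| <= - - (p 2 x / p 1%N x ^+ 2) * p 1%N x ^+ 2.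
      by move=> /(_ H); lra.
    move=> /andP[/ltW ax /ltW xb]; rewrite opprK divfK ?ger0_norm ?psg ?ax//.
    by rewrite expf_neq0// lt0r_neq0// p1_gt0// ax.
  have := oscillation_le ab rho0 d0 d1 prho' dT _ dS.
  suff H x : a < x < b -> `|p 2 x| <= - (p 2 x / p 1%N x ^+ 2) * p 1%N x ^+ 2.
    by move=> /(_ H); lra.
  move=> /andP[/ltW ax /ltW xb]; rewrite mulNr divfK ?ler0_norm ?psg ?ax//.
  by rewrite expf_neq0// lt0r_neq0// p1_gt0// ax.
have rk0 : 0 <= rho ^+ k.+2 by rewrite exprn_ge0// ltW.
have [c [ac cb cl cr]] := growth_zero ab rk0 (dp k.+1 (leqnSn _)) prho.
have h0 : 0 < rho^-1 by rewrite invr_gt0.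
have rhoh : rho ^+ k.+2 / rho = rho ^+ k.+1 by rewrite exprSr mulfK// lt0r_neq0.
have right : `|S b - S c| <= (5 * 2 ^+ k - 2) / rho + rho^-1.
  have [hb|hb] := leP b (c + rho^-1).
    have := cos_antideriv_le cb (antideriv_sub ac (lexx _) dS).
    move=> /le_trans; apply; apply: (@le_trans _ _ rho^-1); first lra.
    rewrite lerDr mulr_ge0 ?invr_ge0 ?(ltW rho0)//.
    by have := @exprn_ege1 R k 2 ltac:(lra); lra.
  have dS1 := antideriv_sub ac (ltW hb) dS.
  have := cos_antideriv_le (ltW (ltr_pwDr h0 (lexx c))) dS1.
  have ac' : a <= c + rho^-1 by lra.
  have := IH (c + rho^-1) b p S (ltW hb) rho0 _ _ _ (antideriv_sub ac' (lexx _) dS).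
  case/(_ _ _ _)/wrap => //.
  - by move=> j jk; apply: antideriv_sub ac' (lexx _) (dp j (leqW jk)).
  - move=> x /andP[cx xb].
    apply: le_trans (cr x _ xb); last by lra.
    by rewrite -rhoh ler_wpM2l//; lra.
  - move=> k0; subst k; left => x /andP[cx xb]; apply: le_trans rk0 (prho x _).
    by rewrite xb (le_trans ac').
  by rewrite !ler_norml; lra.
have left : `|S c - S a| <= (5 * 2 ^+ k - 2) / rho + rho^-1.
  have [hb|hb] := leP (c - rho^-1) a.
    have := cos_antideriv_le ac (antideriv_sub (lexx _) cb dS).
    move=> /le_trans; apply; apply: (@le_trans _ _ rho^-1); first lra.
    rewrite lerDr mulr_ge0 ?invr_ge0 ?(ltW rho0)//.
    by have := @exprn_ege1 R k 2 ltac:(lra); lra.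
  have dS1 := antideriv_sub (ltW hb) cb dS.
  have h1 : c - rho^-1 <= c by lra.
  have := cos_antideriv_le h1 dS1.
  have cb' : c - rho^-1 <= b by lra.
  (* Left of [c] the lower derivative is negative; the phase is negated, which cosine does not
     see. *)
  have dS2 : antideriv a (c - rho^-1) S (fun x => cos (- p 0%N x)).
    rewrite (_ : (fun x => cos (- p 0%N x)) = fun x => cos (p 0%N x)).
      exact: antideriv_sub (lexx _) cb' dS.
    by apply/funext => x; rewrite cosN.
  have := IH a (c - rho^-1) (fun j x => - p j x) S (ltW hb) rho0 _ _ _ dS2.
  case/(_ _ _ _)/wrap => //.
  - move=> j jk; apply: antiderivN.
    by apply: antideriv_sub (lexx _) cb' (dp j (leqW jk)).
  - move=> x /andP[ax xc].
    rewrite lerNr; apply: le_trans (cl x ax _) _; first by lra.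
    by rewrite lerN2 -rhoh ler_wpM2l//; lra.
  - move=> k0; subst k; right => x /andP[ax xc]; rewrite oppr_le0.
    by apply: le_trans rk0 (prho x _); rewrite ax (le_trans xc).
  by rewrite !ler_norml; lra.
move: right left; rewrite exprS !ler_norml.
rewrite [X in _ -> _ -> - X <= _ <= X](_ : _ = ((5 * 2 ^+ k - 2) / rho + rho^-1) +
  ((5 * 2 ^+ k - 2) / rho + rho^-1)); last by ring.
by lra.
Qed.

End VanDerCorput.

(** * Trigonometric sums and Fejer kernels *)

Section TrigonometricSums.
Context (R : realType).

Lemma cos_sum_sqr (T : Type) (r : seq T) (f : T -> R) :
  \sum_(a <- r) \sum_(b <- r) cos (f a - f b) =
  (\sum_(a <- r) cos (f a)) ^+ 2 + (\sum_(a <- r) sin (f a)) ^+ 2.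
Proof.
rewrite !expr2 !mulr_suml -big_split/=; apply: eq_bigr => a _.
rewrite !mulr_sumr -big_split/=; apply: eq_bigr => b _.
by rewrite cosB.
Qed.

(** By the addition formula, what remains is a double sum of sines, which changes sign when [a] and
    [b] are exchanged and hence vanishes. *)
Lemma cos_sum_shift (T : Type) (r : seq T) (f : T -> R) (c : R) :
  \sum_(a <- r) \sum_(b <- r) cos (f a - f b - c) =
  (\sum_(a <- r) \sum_(b <- r) cos (f a - f b)) * cos c.
Proof.
have sum0 : \sum_(a <- r) \sum_(b <- r) sin (f a - f b) = 0.
  suff : \sum_(a <- r) \sum_(b <- r) sin (f a - f b) =
      - \sum_(a <- r) \sum_(b <- r) sin (f a - f b) by lra.
  rewrite [LHS]exchange_big/= -sumrN. apply: eq_bigr => a _.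
  by rewrite -sumrN; apply: eq_bigr => b _; rewrite -sinN opprB.
transitivity (\sum_(a <- r) \sum_(b <- r) cos (f a - f b) * cos c +
   \sum_(a <- r) \sum_(b <- r) sin (f a - f b) * sin c).
  rewrite -big_split/=; apply: eq_bigr => a _.
  by rewrite -big_split/=; apply: eq_bigr => b _; rewrite cosB.
have <- : (\sum_(a <- r) \sum_(b <- r) cos (f a - f b)) * cos c +
    (\sum_(a <- r) \sum_(b <- r) sin (f a - f b)) * sin c =
    (\sum_(a <- r) \sum_(b <- r) cos (f a - f b)) * cos c.
  by rewrite sum0 mul0r addr0.
by rewrite !mulr_suml; congr (_ + _); apply: eq_bigr => a _; rewrite mulr_suml.
Qed.

Definition cis (x : R) : R[i] := (cos x +i* sin x)%C.

(** The squared modulus, as a real polynomial in the two parts, so that its multiplicativity is a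
    ring identity over [R]. *)
Definition sqrnc (z : R[i]) : R := (complex.Re z) ^+ 2 + (complex.Im z) ^+ 2.

Lemma cisD x y : cis (x + y) = cis x * cis y.
Proof.
by rewrite /cis cosD sinD; apply/eqP; rewrite eq_complex /=; apply/andP; split; apply/eqP; ring.
Qed.

Lemma cis0 : cis 0 = 1. Proof. by rewrite /cis cos0 sin0. Qed.

Lemma cis_sum (I : Type) (r : seq I) (F : I -> R) :
  cis (\sum_(i <- r) F i) = \prod_(i <- r) cis (F i).
Proof. exact: (big_morph cis cisD cis0). Qed.

Lemma cisMn (k : nat) x : cis (k%:R * x) = cis x ^+ k.
Proof.
elim: k => [|k IH]; first by rewrite mul0r cis0.
by rewrite exprS -IH -cisD -natr1 mulrDl mul1r addrC.
Qed.

Lemma sqrncM z w : sqrnc (z * w) = sqrnc z * sqrnc w.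
Proof. by case: z w => [a b] [c d]; rewrite /sqrnc/=; ring. Qed.

Lemma sqrnc_prod (I : Type) (r : seq I) (F : I -> R[i]) :
  sqrnc (\prod_(i <- r) F i) = \prod_(i <- r) sqrnc (F i).
Proof.
apply: (big_morph sqrnc sqrncM).
by rewrite /sqrnc /=; ring.
Qed.

Lemma cis_sumE (T : Type) (r : seq T) (f : T -> R) :
  \sum_(a <- r) cis (f a) = ((\sum_(a <- r) cos (f a)) +i* (\sum_(a <- r) sin (f a)))%C.
Proof.
elim: r => [|a r IH]; first by rewrite !big_nil.
by rewrite !big_cons IH.
Qed.

Lemma sqrnc_cis_sum (T : Type) (r : seq T) (f : T -> R) :
  sqrnc (\sum_(a <- r) cis (f a)) = \sum_(a <- r) \sum_(b <- r) cos (f a - f b).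
Proof. by rewrite cis_sumE cos_sum_sqr. Qed.

Definition fejer1 (N : nat) (x : R) : R :=
  \sum_(a < N) \sum_(b < N) cos (a%:R * x - b%:R * x).

Lemma fejer1E N x : fejer1 N x = sqrnc (\sum_(k < N) cis (k%:R * x)).
Proof. by rewrite (sqrnc_cis_sum _ (fun k : 'I_N => k%:R * x)). Qed.

Lemma fejer1_ge0 N x : 0 <= fejer1 N x.
Proof. by rewrite fejer1E addr_ge0 ?sqr_ge0. Qed.

Lemma fejer1_le N x : fejer1 N x <= N%:R ^+ 2.
Proof.
apply: (@le_trans _ _ (\sum_(a < N) \sum_(b < N) 1)).
  by apply: ler_sum => a _; apply: ler_sum => b _; exact: cos_le1.
by rewrite !sumr_const !card_ord expr2 mulr_natr.
Qed.

(** Squared moduli in (1 - z) (1 + z + ... + z^(N-1)) = 1 - z^N for z = exp(i x), since |1 - exp(i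
    y)|^2 = 2 - 2 cos y. *)
Lemma fejer1_geometric N x :
  (2 - 2 * cos x) * fejer1 N x = 2 - 2 * cos (N%:R * x).
Proof.
have E y : sqrnc (1 - cis y) = 2 - 2 * cos y.
  have := cos2Dsin2 y; rewrite /sqrnc/= => h; rewrite -[in X in _ = X]h.
  transitivity (1 - 2 * cos y + (cos y ^+ 2 + sin y ^+ 2)); first by ring.
  by rewrite h; ring.
rewrite -E fejer1E -sqrncM.
rewrite (eq_bigr (fun k : 'I_N => cis x ^+ k)) => [|k _]; last by rewrite cisMn.
by rewrite -[1 - cis x]opprB mulNr -subrX1 opprB -cisMn E.
Qed.

Lemma sin_le_id (x : R) : 0 <= x -> sin x <= x.
Proof.
move=> x0; have d1 := antideriv_comp (@is_derive_sin R) (antideriv_id 0 x).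
have := antideriv_le x0 d1 (antideriv_id 0 x).
rewrite sin0 !subr0; apply=> y _; rewrite mulr1; exact: cos_le1.
Qed.

Lemma cos_ge_parabola (x : R) : 1 - x ^+ 2 / 2 <= cos x.
Proof.
wlog x0 : x / 0 <= x.
  move=> H; have [x0|x0] := leP 0 x; first exact: H.
  by rewrite -cosN -sqrrN; apply: H; lra.
have d1 := antiderivN (antideriv_comp (@is_derive_cos R) (antideriv_id 0 x)).
have d2 := antiderivZ 2^-1 (antiderivM (antideriv_id 0 x) (antideriv_id 0 x)).
have := antideriv_le x0 d1 d2.
rewrite cos0 /= => H; suff : - cos x - -1 <= 2^-1 * (x * x) - 2^-1 * (0 * 0) by lra.
by apply: H => y /andP[/ltW y0 _]; have := sin_le_id y0; lra.
Qed.

Lemma cos_ge_half (x : R) : `|x| <= 1 -> 2^-1 <= cos x.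
Proof.
move=> x1; have := cos_ge_parabola x.
have : x ^+ 2 <= 1 by rewrite -real_normK ?num_real// expr_le1.
by lra.
Qed.

Lemma cos_le_parabola (x : R) : `|x| <= 1 -> cos x <= 1 - x ^+ 2 / 4.
Proof.
wlog x0 : x / 0 <= x.
  move=> H x1; have [x0|x0] := leP 0 x; first exact: H.
  by rewrite -cosN -sqrrN; apply: H; rewrite ?normrN//; lra.
rewrite ger0_norm// => x1.
have sin_ge (y : R) : 0 <= y -> y <= 1 -> y / 2 <= sin y.
  move=> y0 y1; have d1 := antideriv_comp (@is_derive_sin R) (antideriv_id 0 y).
  have := antideriv_le y0 (antiderivZ 2^-1 (antideriv_id 0 y)) d1.
  rewrite sin0 /= => H; suff : 2^-1 * y - 2^-1 * 0 <= sin y - 0 by lra.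
  apply: H => z /andP[z0 z1]; rewrite !mulr1.
  by apply: cos_ge_half; rewrite ger0_norm ?ltW//; lra.
have d1 := antiderivN (antideriv_comp (@is_derive_cos R) (antideriv_id 0 x)).
have d2 := antiderivZ 4^-1 (antiderivM (antideriv_id 0 x) (antideriv_id 0 x)).
have := antideriv_le x0 d2 d1.
rewrite cos0 /= => H; suff : 4^-1 * (x * x) - 4^-1 * (0 * 0) <= - cos x - -1 by lra.
by apply: H => y /andP[/ltW y0 /ltW y1]; have := sin_ge y y0; lra.
Qed.

Lemma fejer1_lower N x : `|N%:R * x| <= 1 -> (N%:R / 2) ^+ 2 <= fejer1 N x.
Proof.
move=> Nx; rewrite /fejer1.
rewrite (cos_sum_sqr (index_enum 'I_N) (fun a : 'I_N => a%:R * x)).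
apply: (@le_trans _ _ ((\sum_(a < N) cos (a%:R * x)) ^+ 2)); last by rewrite lerDl sqr_ge0.
rewrite ler_sqr ?nnegrE; last 2 first.
- by rewrite divr_ge0.
- apply: sumr_ge0 => a _.
  suff : 2^-1 <= cos (a%:R * x) by lra.
  apply: cos_ge_half; apply: le_trans Nx; rewrite !normrM ler_wpM2r// !ger0_norm// ler_nat.
  exact: ltnW.
apply: (@le_trans _ _ (\sum_(a < N) 2^-1)).
  by rewrite sumr_const card_ord mulr_natl.
apply: ler_sum => a _.
apply: cos_ge_half; apply: le_trans Nx; rewrite !normrM ler_wpM2r// !ger0_norm// ler_nat.
exact: ltnW.
Qed.

(** The trivial bound N^2 and the bound 8 / x^2 from the geometric sum add up to 9 N^2 / (1 + (N
    x)^2). Replacing N x by a number [k] within distance 1 costs a factor 3; with [k] an index of a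
    cell, the bound becomes constant on cells. The restriction on [x] keeps away from the other
    periods. *)
Lemma fejer1_decay N x (k : R) : `|x| <= 1 -> `|N%:R * x - k| <= 1 ->
  fejer1 N x <= 27 * N%:R ^+ 2 / (1 + k ^+ 2).
Proof.
move=> x1 xk.
have F0 := fejer1_ge0 N x.
have F8 : fejer1 N x * x ^+ 2 <= 8.
  have c1 := cos_le_parabola x1.
  have H : (x ^+ 2 / 2) * fejer1 N x <= (2 - 2 * cos x) * fejer1 N x.
    by rewrite ler_wpM2r//; lra.
  rewrite fejer1_geometric in H.
  by have := cos_geN1 (N%:R * x); lra.
have F9 : fejer1 N x * (1 + (N%:R * x) ^+ 2) <= 9 * N%:R ^+ 2.
  rewrite mulrDr mulr1 exprMn mulrCA.
  have := fejer1_le N x; have : N%:R ^+ 2 * (fejer1 N x * x ^+ 2) <= N%:R ^+ 2 * 8.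
    by rewrite ler_wpM2l// sqr_ge0.
  by lra.
have k1 : 0 < 1 + k ^+ 2 by have := sqr_ge0 k; lra.
rewrite ler_pdivlMr//.
have : 1 + k ^+ 2 <= 3 * (1 + (N%:R * x) ^+ 2).
  move: xk; set u := N%:R * x; rewrite ler_norml => /andP[u1 u2].
  have : k ^+ 2 <= 2 * u ^+ 2 + 2 * (u - k) ^+ 2.
    have := sqr_ge0 (2 * u - k); lra.
  have : (u - k) ^+ 2 <= 1 by nra.
  by have := sqr_ge0 u; lra.
move=> /(ler_wpM2l F0); lra.
Qed.

(** Comparison with the derivative of the arctangent: on a unit interval starting at an integer u it
    is at least a third of 1 / (1 + u^2), and the total increase of the arctangent is at most pi. *)
Lemma sum_inv_sqr_le (n m : nat) :
  \sum_(k < n) (1 + (k%:R - m%:R) ^+ 2)^-1 <= 3 * pi :> R.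
Proof.
apply: (@le_trans _ _ (3 * (atan (n%:R - m%:R) - atan (- m%:R)))); last first.
  have := @atan_ltpi2 R (n%:R - m%:R); have := @atan_gtNpi2 R (- m%:R); lra.
elim: n => [|n IH]; first by rewrite big_ord0 sub0r subrr mulr0.
rewrite big_ord_recr/=; set u := n%:R - m%:R in IH *.
have -> : n.+1%:R - m%:R = u + 1 :> R by rewrite /u -natr1; ring.
have d1 := antideriv_comp (@is_derive1_atan R) (antideriv_id u (u + 1)).
have d2 := antiderivZ (3^-1 * (1 + u ^+ 2)^-1) (antideriv_id u (u + 1)).
have H : (3^-1 * (1 + u ^+ 2)^-1) * (u + 1) - (3^-1 * (1 + u ^+ 2)^-1) * u <=
    atan (u + 1) - atan u.
  apply: (antideriv_le _ d2 d1); first by lra.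
  move=> y /andP[y0 y1]; rewrite !mulr1 -invfM lef_pV2 ?posrE.
  - have : y ^+ 2 <= 2 * u ^+ 2 + 2 * (u - y) ^+ 2.
      have := sqr_ge0 (2 * u - y); lra.
    have : (u - y) ^+ 2 <= 1 by nra.
    by have := sqr_ge0 u; lra.
  - by have := sqr_ge0 u; lra.
  - by have := sqr_ge0 y; lra.
by lra.
Qed.

End TrigonometricSums.

(** * Fejer kernels in several variables and sums over pairs of frequencies *)

Section FejerKernel.
Context (R : realType) (d : nat).
Implicit Types (m v : 'I_d -> R).

Definition dot m v : R := \sum_i m i * v i.

Definition fdiff N (a b : {ffun 'I_d -> 'I_N}) : 'I_d -> R :=
  fun i => (a i)%:R - (b i)%:R.

Definition fejer N v : R :=
  \sum_(a : {ffun 'I_d -> 'I_N}) \sum_(b : {ffun 'I_d -> 'I_N}) cos (dot (fdiff a b) v).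

Lemma fejerE N v : fejer N v = \prod_i fejer1 N (v i).
Proof.
under eq_bigr do rewrite fejer1E.
rewrite -sqrnc_prod bigA_distr_bigA /=.
pose th (a : {ffun 'I_d -> 'I_N}) := \sum_i (a i)%:R * v i.
rewrite (eq_bigr (fun a => cis (th a))) => [|a _]; last by rewrite cis_sum.
rewrite sqrnc_cis_sum; apply: eq_bigr => a _; apply: eq_bigr => b _.
by rewrite /th -sumrB; congr cos; apply: eq_bigr => i _; rewrite mulrBl.
Qed.

Lemma fejer_ge0 N v : 0 <= fejer N v.
Proof. by rewrite fejerE prodr_ge0// => i _; exact: fejer1_ge0. Qed.

Lemma fejer_lower N v : (forall i, `|N%:R * v i| <= 1) ->
  (N%:R / 2) ^+ 2 ^+ d <= fejer N v.
Proof.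
move=> Nv; rewrite fejerE -[in leLHS](card_ord d) -prodr_const.
apply: ler_prod => i _; rewrite sqr_ge0/=; exact: fejer1_lower.
Qed.

(* For |v i| <= 1; the shift by M keeps the integer part of M * v i nonnegative. *)
Definition cell M v : {ffun 'I_d -> 'I_(2 * M).+1} :=
  [ffun i => inord (Num.truncn (M%:R * v i + M%:R))].

Lemma cell_itv M v i : `|v i| <= 1 ->
  (cell M v i)%:R <= M%:R * v i + M%:R < (cell M v i)%:R + 1.
Proof.
move=> v1; rewrite ffunE.
have Mv : `|M%:R * v i| <= M%:R by rewrite normrM normr_nat ler_piMr.
move: Mv; rewrite ler_norml => /andP[Mv1 Mv2].
have M0 : 0 <= M%:R * v i + M%:R by lra.
rewrite inordK; first by rewrite natr1 truncn_itv.
rewrite truncn_lt_nat// -natr1 natrM; lra.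
Qed.

Lemma cell_eq M v v' i : `|v i| <= 1 -> `|v' i| <= 1 -> cell M v = cell M v' ->
  M%:R * `|v i - v' i| < 1.
Proof.
move=> v1 v1' e; have := cell_itv M v1; have := cell_itv M v1'.
rewrite e -[M%:R as X in X * `|_|]normr_nat -normrM ltr_norml; lra.
Qed.

(** By [fejer1_decay] the kernel is at most a product of weights depending only on the cell, and
    each cell holds at most [B] points. The sum over cells factors into one-dimensional sums, each
    at most 27 M^2 * 3 pi. *)
Lemma fejer_sum_le (T : eqType) (P : seq T) (v : T -> 'I_d -> R) M (B : R) :
  {in P, forall q i, `|v q i| <= 1} ->
  (forall k, (size [seq q <- P | cell M (v q) == k])%:R <= B) ->
  \sum_(q <- P) fejer M (v q) <= B * (81 * pi * M%:R ^+ 2) ^+ d.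
Proof.
move=> v1 cB.
pose g (k : nat) : R := 27 * M%:R ^+ 2 / (1 + (k%:R - M%:R) ^+ 2).
have g0 k : 0 <= g k.
  rewrite divr_ge0 ?mulr_ge0 ?sqr_ge0//.
  by have := sqr_ge0 (k%:R - M%:R : R); lra.
pose G (k : {ffun 'I_d -> 'I_(2 * M).+1}) := \prod_i g (k i).
have G0 k : 0 <= G k by apply: prodr_ge0 => i _; exact: g0.
apply: (@le_trans _ _ (\sum_(q <- P) G (cell M (v q)))).
  rewrite big_seq [leRHS]big_seq; apply: ler_sum => q qP; rewrite fejerE; apply: ler_prod => i _.
  rewrite fejer1_ge0/=; apply: fejer1_decay; first exact: v1.
  have := cell_itv M (v1 q qP i); rewrite ler_norml; lra.
rewrite (partition_big (fun q => cell M (v q)) xpredT)//=.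
apply: (@le_trans _ _ (\sum_k B * G k)).
  apply: ler_sum => k _.
  rewrite (eq_bigr (fun=> G k)) => [|q /eqP->//].
  by rewrite -big_filter big_const_seq count_predT iter_addr_0 -mulr_natl ler_wpM2r.
rewrite -mulr_sumr /G -(bigA_distr_bigA (fun (_ : 'I_d) (k : 'I_(2 * M).+1) => g k)) /=.
rewrite ler_wpM2l//; first by apply: le_trans (cB (cell M (fun=> 0))).
rewrite prodr_const card_ord lerXn2r ?nnegrE ?sumr_ge0//.
  by rewrite mulr_ge0 ?sqr_ge0// mulr_ge0// pi_ge0.
rewrite /g -mulr_sumr.
apply: (@le_trans _ _ (27 * M%:R ^+ 2 * (3 * pi))); last by lra.
by rewrite ler_wpM2l ?sum_inv_sqr_le// mulr_ge0 ?sqr_ge0.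
Qed.

(** The weight H(m) of the overview, for the points [y p]: by [cos_sum_sqr] it is the squared
    modulus of the sum of exp(i m.y(p)). *)
Definition energy (T : Type) (P : seq T) (y : T -> 'I_d -> R) m : R :=
  \sum_(p <- P) \sum_(q <- P) cos (dot m (y p) - dot m (y q)).

Lemma dotB m v v' : dot m (fun i => v i - v' i) = dot m v - dot m v'.
Proof. by rewrite /dot -sumrB; apply: eq_bigr => i _; rewrite mulrBr. Qed.

Lemma energy_ge0 (T : Type) (P : seq T) (y : T -> 'I_d -> R) m : 0 <= energy P y m.
Proof. by rewrite /energy cos_sum_sqr addr_ge0 ?sqr_ge0. Qed.

Lemma fejer_energy (T : Type) (P : seq T) (y : T -> 'I_d -> R) N (u : 'I_d -> R) :
  \sum_(p <- P) \sum_(q <- P) fejer N (fun i => y p i - y q i - u i) =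
  \sum_(a : {ffun 'I_d -> 'I_N}) \sum_(b : {ffun 'I_d -> 'I_N})
     energy P y (fdiff a b) * cos (dot (fdiff a b) u).
Proof.
rewrite /fejer; under eq_bigr do rewrite exchange_big/=.
rewrite exchange_big/=; apply: eq_bigr => a _.
under eq_bigr do rewrite exchange_big/=.
rewrite exchange_big/=; apply: eq_bigr => b _.
rewrite /energy -cos_sum_shift; apply: eq_bigr => p _; apply: eq_bigr => q _.
by rewrite -!dotB.
Qed.

Definition close M N (a b : {ffun 'I_d -> 'I_N}) : bool :=
  [forall i, (a i < b i + M)%N && (b i < a i + M)%N].

Lemma sum_le_inj (A B : finType) (P : pred A) (h : A -> B) (g : B -> R) :
  {in P &, injective h} -> (forall b, 0 <= g b) ->
  \sum_(a | P a) g (h a) <= \sum_b g b.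
Proof.
move=> hinj g0.
rewrite -[leLHS](@big_imset _ _ _ _ _ h P g hinj).
by rewrite [leRHS](bigID (mem [set h x | x in P]%SET))/= lerDl sumr_ge0.
Qed.

(* A pair of frequencies at distance < M is the translate by M x, x = min(a, b) / M,
   of a pair with entries < 2 M. *)
Lemma close_sum_le (h : ('I_d -> R) -> R) N Q M :
  N = (Q * M)%N -> (0 < M)%N -> (forall m, 0 <= h m) ->
  \sum_(a : {ffun 'I_d -> 'I_N})
    \sum_(b : {ffun 'I_d -> 'I_N} | close M a b) h (fdiff a b) <=
  Q%:R ^+ d * \sum_(a : {ffun 'I_d -> 'I_(2 * M)}) \sum_(b : {ffun 'I_d -> 'I_(2 * M)})
     h (fdiff a b).
Proof.
move=> -> M0 h0; rewrite !pair_big_dep/=.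
have M20 : (0 < 2 * M)%N by rewrite muln_gt0.
have xlt (a b : 'I_(Q * M)) : (minn a b %/ M < Q)%N.
  by rewrite ltn_divLR// (leq_ltn_trans (geq_minl a b)).
pose X (z : {ffun 'I_d -> 'I_(Q * M)} * {ffun 'I_d -> 'I_(Q * M)}) : {ffun 'I_d -> 'I_Q} :=
  [ffun i => Ordinal (xlt (z.1 i) (z.2 i))].
(* The reduction modulo [2 * M] only makes [sh] total: by [shE] it changes nothing on close
   pairs. *)
pose sh (a : {ffun 'I_d -> 'I_(Q * M)}) (x : {ffun 'I_d -> 'I_Q}) : {ffun 'I_d -> 'I_(2 * M)} :=
  [ffun i => Ordinal (ltn_pmod (a i - M * x i) M20)].
pose H z := (X z, (sh z.1 (X z), sh z.2 (X z))).
have shE z i : close M z.1 z.2 ->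
    (sh z.1 (X z) i + M * X z i = z.1 i :> nat)%N /\
    (sh z.2 (X z) i + M * X z i = z.2 i :> nat)%N.
  move=> /forallP/(_ i)/andP[c1 c2]; rewrite !ffunE /=.
  have := divn_eq (minn (z.1 i) (z.2 i)) M.
  have := ltn_pmod (minn (z.1 i) (z.2 i)) M0.
  set r := (_ %% M)%N; set x := (_ %/ M)%N => rM e.
  have l1 : (M * x <= z.1 i)%N by apply: leq_trans (geq_minl _ (z.2 i)); rewrite e mulnC leq_addr.
  have l2 : (M * x <= z.2 i)%N by apply: leq_trans (geq_minr (z.1 i) _); rewrite e mulnC leq_addr.
  have [ab|ab] := leqP (z.1 i) (z.2 i).
    move: e; rewrite (minn_idPl ab) => e.
    by rewrite !modn_small ?subnK//; move: rM e c1 c2; clear; lia.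
  move: e; rewrite (minn_idPr (ltnW ab)) => e.
  by rewrite !modn_small ?subnK//; move: rM e c1 c2; clear; lia.
have Hinj : {in (fun z => close M z.1 z.2) &, injective H}.
  move=> [a b] [a' b'] zc zc' [eX e1 e2].
  congr (_, _); apply/ffunP => i; apply: val_inj => /=.
    by rewrite -(shE _ i zc).1 -(shE _ i zc').1 /= e1 eX.
  by rewrite -(shE _ i zc).2 -(shE _ i zc').2 /= e2 eX.
have HE z : close M z.1 z.2 -> h (fdiff z.1 z.2) = h (fdiff (H z).2.1 (H z).2.2).
  move=> zc; congr h; apply/funext => i; rewrite /fdiff.
  rewrite -(shE _ i zc).1 -(shE _ i zc).2 !natrD /=; ring.
rewrite (eq_bigr _ HE).
apply: le_trans (sum_le_inj Hinj (g := fun w => h (fdiff w.2.1 w.2.2)) _) _ => //.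
rewrite -(pair_big xpredT xpredT (fun _ w => h (fdiff w.1 w.2)))/=.
by rewrite sumr_const card_ffun !card_ord -natrX mulr_natl.
Qed.

(** Each pair is charged to the least [j] with [close (2 ^ j) a b], which exists because all pairs
    are close at scale [2 ^ J]. As [h] is nonnegative, the pairs charged to [j] may be completed to
    all pairs close at that scale, to which [close_sum_le] applies. *)
Lemma shell_sum_le (h : ('I_d -> R) -> R) J
    (w : {ffun 'I_d -> 'I_(2 ^ J)} -> {ffun 'I_d -> 'I_(2 ^ J)} -> R) (C th : R) (A : nat -> R) :
  0 <= C -> 0 <= th -> (forall m, 0 <= h m) ->
  (forall a b, w a b <= C) ->
  (forall a b j, ~~ close (2 ^ j) a b -> w a b <= C * th ^+ j.+1) ->
  (forall j, (j <= J)%N ->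
    \sum_(a : {ffun 'I_d -> 'I_(2 * 2 ^ j)}) \sum_(b : {ffun 'I_d -> 'I_(2 * 2 ^ j)})
      h (fdiff a b) <= A j) ->
  \sum_a \sum_b h (fdiff a b) * w a b <=
  \sum_(j < J.+1) C * th ^+ j * ((2 ^ (J - j))%:R ^+ d * A j).
Proof.
move=> C0 th0 h0 w0 wj hA.
apply: (@le_trans _ _ (\sum_(a : {ffun 'I_d -> 'I_(2 ^ J)}) \sum_(b : {ffun 'I_d -> 'I_(2 ^ J)})
    \sum_(j < J.+1) C * th ^+ j * (if close (2 ^ j) a b then h (fdiff a b) else 0))).
  apply: ler_sum => a _; apply: ler_sum => b _.
  have cJ : close (2 ^ J) a b.
    by apply/forallP => i; rewrite !(leq_trans (ltn_ord _) (leq_addl _ _)).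
  have ex : exists j, close (2 ^ j) a b by exists J.
  have [j cj jmin] := ex_minnP ex.
  have jJ : (j < J.+1)%N by rewrite ltnS jmin.
  rewrite (bigD1 (Ordinal jJ))//= cj mulrC.
  apply: (@le_trans _ _ (C * th ^+ j * h (fdiff a b))); last first.
    rewrite lerDl sumr_ge0// => k _; rewrite !mulr_ge0 ?exprn_ge0//; by case: ifP.
  (* For [j = 0] the pair is diagonal and only the bound [C] is available. Otherwise minimality says
     that the pair is not close at the previous scale, hence the exponent [j.+1] in the
     hypothesis. *)
  rewrite ler_wpM2r//; case: j jmin {cj jJ} => [|j] jmin; first by rewrite mulr1.
  by apply: wj; apply/negP => /jmin; rewrite ltnn.
under eq_bigr do rewrite exchange_big/=.
rewrite exchange_big/=; apply: ler_sum => j _.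
under eq_bigr do rewrite -mulr_sumr.
rewrite -mulr_sumr ler_wpM2l ?mulr_ge0 ?exprn_ge0//.
under eq_bigr do rewrite -big_mkcond/=.
have jJ : (j <= J)%N by rewrite -ltnS.
apply: (@le_trans _ _ ((2 ^ (J - j))%:R ^+ d * \sum_(a : {ffun 'I_d -> 'I_(2 * 2 ^ j)})
  \sum_(b : {ffun 'I_d -> 'I_(2 * 2 ^ j)}) h (fdiff a b))).
  by apply: close_sum_le; rewrite ?expn_gt0// -expnD subnK.
by rewrite ler_wpM2l ?hA.
Qed.

End FejerKernel.

(** * Oscillatory integrals along non-degenerate curves *)

Section CurveDecay.
Context (R : realType).

Lemma antideriv_bounded (F f : R -> R) : antideriv 0 1 F f ->
  exists K : R, forall s, 0 <= s <= 1 -> `|F s| <= K.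
Proof.
move=> [_ cF].
have cF' : {within `[0, 1], continuous F}.
  by apply/subspace_continuousP => x /=; rewrite in_itv/=; exact: cF.
have [c _ cM] := EVT_max ler01 cF'; have [c' _ cm] := EVT_min ler01 cF'.
exists (`|F c| + `|F c'|) => s s01.
have := cM s; have := cm s; rewrite in_itv/= => /(_ s01) + /(_ s01).
rewrite ler_norml.
have := ler_norm (F c); have := ler_norm (- F c'); rewrite normrN.
have := normr_ge0 (F c); have := normr_ge0 (F c'); lra.
Qed.

(** What is ultimately used of these functions is continuity on [0, 1]; in this form it passes
    through sums, products and determinants by the rules for [antideriv]. *)
Definition has_deriv01 (F : R -> R) := exists f, antideriv 0 1 F f.

Lemma has_deriv01_sum (I : Type) (r : seq I) (F : I -> R -> R) :
  (forall i, has_deriv01 (F i)) -> has_deriv01 (fun x => \sum_(i <- r) F i x).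
Proof.
by move=> /choice[f df]; eexists; apply: antideriv_sum => i _; exact: df.
Qed.

Lemma has_deriv01M (F G : R -> R) : has_deriv01 F -> has_deriv01 G ->
  has_deriv01 (fun x => F x * G x).
Proof. by move=> [f df] [g dg]; eexists; exact: antiderivM df dg. Qed.

Lemma has_deriv01_cst (c : R) : has_deriv01 (fun=> c).
Proof. by exists (fun=> 0); exact: antideriv_cst. Qed.

Lemma has_deriv01_prod (I : Type) (r : seq I) (F : I -> R -> R) :
  (forall i, has_deriv01 (F i)) -> has_deriv01 (fun x => \prod_(i <- r) F i x).
Proof.
move=> dF; elim: r => [|i r IH].
  rewrite (_ : (fun x => _) = fun=> 1); first exact: has_deriv01_cst.
  by apply/funext => x; rewrite big_nil.
rewrite (_ : (fun x => _) = fun x => F i x * \prod_(j <- r) F j x).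
  exact: has_deriv01M.
by apply/funext => x; rewrite big_cons.
Qed.

Lemma has_deriv01_det d (A : R -> 'M[R]_d) :
  (forall i j, has_deriv01 (fun s => A s i j)) -> has_deriv01 (fun s => \det (A s)).
Proof.
move=> dA; apply: has_deriv01_sum => s.
by apply: has_deriv01M; [exact: has_deriv01_cst|apply: has_deriv01_prod => i; exact: dA].
Qed.

Lemma det_norm_le d (A : 'M[R]_d) (B : R) : (forall i j, `|A i j| <= B) ->
  `|\det A| <= #|{: {perm 'I_d}}|%:R * B ^+ d.
Proof.
move=> AB; apply: le_trans (ler_norm_sum _ _ _) _.
apply: (@le_trans _ _ (\sum_(s : {perm 'I_d}) B ^+ d)); last first.
  by rewrite sumr_const mulr_natl.
apply: ler_sum => s _; rewrite normrM normrX normrN1 expr1n mul1r normr_prod.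
rewrite -[in leRHS](card_ord d) -prodr_const; apply: ler_prod => i _.
by rewrite normr_ge0 AB.
Qed.

(** * Lower bounds along a non-degenerate curve, [g k i] being the [k]-th derivative of coordinate
    [i] *)

Section Nondegenerate.
Context (d : nat) (g : nat -> 'I_d -> R -> R).
Context (dg : forall k i, antideriv 0 1 (g k i) (g k.+1 i)).
Context (detg : forall s : R, 0 <= s <= 1 -> \det (\matrix_(j < d, i < d) g j.+1 i s) != 0).

Lemma curve_bounded (n : nat) :
  exists2 B : R, 0 < B & forall k i s, (k <= n)%N -> 0 <= s <= 1 -> `|g k i s| <= B.
Proof.
have /choice[K KP] : forall ki : nat * 'I_d, exists K : R,
    forall s, 0 <= s <= 1 -> `|g ki.1 ki.2 s| <= K.
  by move=> [k i]; exact: antideriv_bounded (dg k i).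
have K0 ki : 0 <= K ki.
  have := KP ki 0; rewrite lexx ler01 => /(_ isT); exact: le_trans.
exists (1 + \sum_(k < n.+1) \sum_i K (nat_of_ord k, i)).
  by rewrite ltr_pwDl// !sumr_ge0// => k _; exact: sumr_ge0.
move=> k i s kn s01; apply: le_trans (KP (k, i) s s01) _.
have kn' : (k < n.+1)%N by [].
rewrite (bigD1 (Ordinal kn'))//= (bigD1 i)//=.
set u := K _; set v := \sum_(_ | _) _; set w := \sum_(_ | _) _.
have : 0 <= v by apply: sumr_ge0.
have : 0 <= w by apply: sumr_ge0 => ? _; apply: sumr_ge0.
lra.
Qed.

(* If u := A m with A invertible then m \det A = \adj A u, so u has an entry comparable to m. *)
Lemma nondegenerate_lower : exists2 c : R, 0 < c <= 1 &
  forall (m : 'I_d -> R) (s : R) i, 0 <= s <= 1 ->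
    exists j : 'I_d, c * `|m i| <= `|dot m (fun i => g j.+1 i s)|.
Proof.
pose A s : 'M[R]_d := \matrix_(j < d, i < d) g j.+1 i s.
(* The square of the determinant, unlike its absolute value, stays in [has_deriv01]; its minimum on
   [0, 1] keeps the determinant uniformly away from 0. *)
have [D' dD] : has_deriv01 (fun s => \det (A s) * \det (A s)).
  apply: has_deriv01M; apply: has_deriv01_det => i j; exists (g i.+2 j).
    by rewrite (_ : (fun s => _) = g i.+1 j)//; apply/funext => s; rewrite mxE.
  by rewrite (_ : (fun s => _) = g i.+1 j)//; apply/funext => s; rewrite mxE.
have cD : {within `[0, 1], continuous (fun s => \det (A s) * \det (A s))}.
  by apply/subspace_continuousP => x /=; rewrite in_itv/=; exact: dD.2.
have [s0] := EVT_min ler01 cD; rewrite in_itv/= => s01 Dmin.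
set D0 := `|\det (A s0)|.
have D0_gt0 : 0 < D0 by rewrite normr_gt0; exact: detg.
have Dge s : 0 <= s <= 1 -> D0 <= `|\det (A s)|.
  move=> s1; have := Dmin s; rewrite in_itv/= => /(_ s1).
  by rewrite -!expr2 -ler_sqrt ?sqr_ge0// !sqrtr_sqr.
have [B B0 gB] := curve_bounded d.
pose K : R := #|{: {perm 'I_d.-1}}|%:R * B ^+ d.-1.
have K0 : 0 <= K by rewrite mulr_ge0// exprn_ge0// ltW.
have adjK s i j : 0 <= s <= 1 -> `|\adj (A s) i j| <= K.
  move=> s1; rewrite mxE normrM normrX normrN1 expr1n mul1r.
  by apply: det_norm_le => i' j'; rewrite !mxE gB.
(* [L] exceeds [D0], so that the constant is at most 1, and [d%:R * K], so that entries of A m all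
   below it would give [D0 * |m i| <= D0 * |m i| / 2]. *)
pose L := 1 + D0 + d%:R * K.
have L0 : 0 < L by rewrite /L; have := mulr_ge0 (ler0n R d) K0; lra.
have Kd0 : 0 <= d%:R * K by rewrite mulr_ge0.
exists (D0 / (2 * L)).
  rewrite divr_gt0 ?mulr_gt0//= ler_pdivrMr ?mulr_gt0//.
  by rewrite /L; lra.
move=> m s i s1; apply: contrapT => /forallNP H.
have H' (j : 'I_d) : `|dot m (fun i => g j.+1 i s)| < D0 / (2 * L) * `|m i|.
  by rewrite ltNge; apply/negP => h; exact: (H j h).
have mi0 : 0 < `|m i|.
  have := le_lt_trans (normr_ge0 _) (H' i).
  by rewrite pmulr_rgt0// divr_gt0 ?mulr_gt0.
have E : \det (A s) * m i = \sum_j \adj (A s) i j * dot m (fun i => g j.+1 i s).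
  have /matrixP/(_ i (0 : 'I_1)) : 
      \adj (A s) *m (A s *m \col_i m i) = (\det (A s))%:M *m \col_i m i.
    by rewrite mulmxA mul_adj_mx.
  rewrite mul_scalar_mx !mxE => <-; apply: eq_bigr => j _; congr (_ * _).
  by rewrite mxE; apply: eq_bigr => k _; rewrite !mxE mulrC.
have : D0 * `|m i| <= d%:R * K * (D0 / (2 * L) * `|m i|).
  apply: (@le_trans _ _ `|\det (A s) * m i|); first by rewrite normrM ler_wpM2r// Dge.
  rewrite E; apply: le_trans (ler_norm_sum _ _ _) _.
  apply: (@le_trans _ _ (\sum_(j < d) K * (D0 / (2 * L) * `|m i|))).
    by apply: ler_sum => j _; rewrite normrM ler_pM// ?adjK// ltW.
  by rewrite sumr_const card_ord -[leLHS]mulr_natl mulrA.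
have -> : d%:R * K * (D0 / (2 * L) * `|m i|) = (D0 * `|m i|) * ((d%:R * K) / (2 * L)).
  by field; exact: lt0r_neq0.
rewrite -[leLHS]mulr1 ler_pM2l ?mulr_gt0// ler_pdivlMr ?mulr_gt0//.
rewrite /L; lra.
Qed.

End Nondegenerate.

(** For first derivatives monotonicity is not at hand, and the bound on [p 2] replaces it in
    [oscillation_le]. For higher orders [van_der_corput] applies with [rho = c * lam], since (c
    lam)^(j+1) <= c lam^d <= c l when c <= 1 <= lam. *)
Lemma oscillation_decay d (j : 'I_d) (p : nat -> R -> R) (a b c B l lam : R) (S : R -> R) :
  0 <= a -> a <= b -> b <= 1 -> 0 < c <= 1 -> 0 <= B -> 1 <= lam -> lam ^+ d <= l ->
  (forall k, antideriv 0 1 (p k) (p k.+1)) ->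
  (forall x, a <= x <= b -> c * l <= p j.+1 x) ->
  (forall x, a <= x <= b -> `|p 2 x| <= B * l) ->
  antideriv 0 1 S (fun x => cos (p 0%N x)) ->
  `|S b - S a| <= (5 * 2 ^+ d / c + 2 / c + B / c ^+ 2) / lam.
Proof.
move=> a0 ab b1 /andP[c0 c1] B0 lam1 laml dp pj p2 dS.
have lam0 : 0 < lam by lra.
have dp' k := antideriv_sub a0 b1 (dp k).
have dS' := antideriv_sub a0 b1 dS.
have jd : (j < d)%N by [].
have Bc0 : 0 <= B / c ^+ 2 by rewrite divr_ge0 ?sqr_ge0.
have c20 : 0 <= 2 / c by rewrite divr_ge0 ?ltW.
case ej : (j : nat) => [|k]; rewrite ej in pj jd.
  have laml' : lam <= l.
    by apply: le_trans laml; rewrite -[leLHS]expr1 ler_weXn2l.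
  have l0 : 0 < l by lra.
  have cl0 : 0 < c * l by rewrite mulr_gt0.
  have := oscillation_le ab cl0 (dp' 0%N) (dp' 1%N) pj
    (antiderivZ (B * l / (c * l) ^+ 2) (antideriv_id a b)) _ dS'.
  case/(_ _)/wrap => [x /andP[/ltW ax /ltW xb]|].
    rewrite mulr1; apply: le_trans (p2 x _) _; first by rewrite ax.
    rewrite mulrAC ler_pdivlMr ?exprn_gt0// ler_wpM2l//; first by rewrite mulr_ge0// ltW.
    by rewrite ler_sqr ?nnegrE ?(ltW cl0) ?pj ?ax// (le_trans (ltW cl0))// pj ?ax.
  move=> /le_trans; apply.
  rewrite -mulrBr.
  apply: (@le_trans _ _ ((2 / c + B / c ^+ 2) / l)).
    have -> : (2 / c + B / c ^+ 2) / l = 2 / (c * l) + B * l / (c * l) ^+ 2 * 1.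
      by field; rewrite !lt0r_neq0.
    rewrite lerD2l ler_wpM2l//; last by lra.
    by rewrite divr_ge0 ?sqr_ge0// mulr_ge0// ltW.
  apply: (@le_trans _ _ ((2 / c + B / c ^+ 2) / lam)).
    rewrite ler_wpM2l ?addr_ge0// lef_pV2 ?posrE//; lra.
  by rewrite ler_wpM2r ?invr_ge0 ?(ltW lam0)// -[leRHS]addrA lerDr
    divr_ge0 ?mulr_ge0 ?exprn_ge0// ltW.
have cl0 : 0 < c * lam by rewrite mulr_gt0.
have := @van_der_corput R k.+1 a b p (c * lam) S ab cl0 (fun j _ => dp' j) _ _ dS'.
case/(_ _ _)/wrap => [x xab|//|].
  apply: le_trans (pj x xab); rewrite exprMn ler_pM ?exprn_ge0 ?(ltW c0) ?(ltW lam0)//.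
    by rewrite exprS ler_piMr ?(ltW c0)// exprn_ile1// ltW.
  by apply: le_trans laml; rewrite ler_weXn2l.
move=> /le_trans; apply.
have -> : (5 * 2 ^+ k.+1 - 2) / (c * lam) = (5 * 2 ^+ k.+1 - 2) / c / lam.
  by field; rewrite !lt0r_neq0.
rewrite ler_wpM2r ?invr_ge0 ?(ltW lam0)//.
apply: (@le_trans _ _ (5 * 2 ^+ d / c)); last by lra.
rewrite ler_wpM2r ?invr_ge0 ?(ltW c0)//.
have : 2 ^+ k.+1 <= 2 ^+ d :> R by rewrite ler_weXn2l ?ler1n// ltnW.
lra.
Qed.

Lemma dot_norm_le d (m v : 'I_d -> R) (l B : R) : 0 <= l -> (forall i, `|m i| <= l) ->
  (forall i, `|v i| <= B) -> `|dot m v| <= d%:R * B * l.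
Proof.
move=> l0 ml vB; apply: le_trans (ler_norm_sum _ _ _) _.
apply: (@le_trans _ _ (\sum_(i < d) B * l)).
  by apply: ler_sum => i _; rewrite normrM mulrC ler_pM.
by rewrite sumr_const card_ord -[leLHS]mulr_natl mulrA.
Qed.

(** The order of the large derivative depends on [s] and [m]. The segment is cut into [K] equal
    pieces, with [K] independent of [m], so short that each derivative of order at most d varies by
    at most half the lower bound; the order found at the left end of a piece then serves on all of
    it, with a constant sign. The parameter [lam] expresses decay of order |m|^(-1/d) without
    roots. *)
Lemma curve_decay d (g : nat -> 'I_d -> R -> R) :
  (forall k i, antideriv 0 1 (g k i) (g k.+1 i)) ->
  (forall s : R, 0 <= s <= 1 -> \det (\matrix_(j < d, i < d) g j.+1 i s) != 0) ->
  exists2 C : R, 0 < C & forall (m : 'I_d -> R) (e : R) (i0 : 'I_d) (lam : R) (S : R -> R),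
    0 < lam -> lam ^+ d <= `|m i0| -> (forall i, `|m i| <= `|m i0|) ->
    antideriv 0 1 S (fun s => cos (dot m (fun i => g 0%N i s) + e)) ->
    `|S 1 - S 0| <= C / lam.
Proof.
move=> dg detg.
have [c /andP[c0 c1] clow] := nondegenerate_lower dg detg.
(* Order [d.+1] is needed to control the variation of the derivative of order [d]. *)
have [B B0 gB] := curve_bounded dg d.+1.
pose K := (Num.truncn (2 * d%:R * B / c)).+1.
have K0 : 0 < K%:R :> R by rewrite ltr0n.
have dBK : d%:R * B / K%:R <= c / 2.
  have : 2 * d%:R * B / c < K%:R by exact: truncnS_gt.
  rewrite ltr_pdivrMr// => h; rewrite ler_pdivrMr//; lra.
set b := c / 2.
pose C1 := 5 * 2 ^+ d / b + 2 / b + d%:R * B / b ^+ 2.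
have b0 : 0 < b by rewrite divr_gt0.
have C10 : 0 <= C1.
  by rewrite /C1 !addr_ge0// divr_ge0 ?mulr_ge0 ?sqr_ge0 ?exprn_ge0 ?(ltW c0) ?(ltW B0).
exists (1 + K%:R * C1); first by rewrite ltr_pwDl// mulr_ge0.
move=> m e i0 lam S lam0 laml ml dS.
set l := `|m i0| in laml ml.
have [lam1|lam1] := ltP lam 1.
  have := cos_antideriv_le ler01 dS; move=> /le_trans; apply.
  rewrite subr0 ler_pdivlMr// mul1r; have := mulr_ge0 (ltW K0) C10; lra.
pose p k s : R := dot m (fun i => g k i s) + (if k is 0%N then e else 0).
have dp k : antideriv 0 1 (p k) (p k.+1).
  apply: antiderivD; last exact: antideriv_cst.
  by apply: antideriv_sum => i _; apply: antiderivZ; exact: dg.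
have dS0 : antideriv 0 1 S (fun x => cos (p 0%N x)) by [].
have d0 : (0 < d)%N by apply: leq_ltn_trans (ltn_ord i0).
have piece k : (k < K)%N -> `|S (k.+1%:R / K%:R) - S (k%:R / K%:R)| <= C1 / lam.
  move=> kK; set s := k%:R / K%:R; set s' := k.+1%:R / K%:R.
  have s0 : 0 <= s by rewrite divr_ge0.
  have ss' : s' - s = K%:R^-1 by rewrite /s' /s -mulrBl -natr1 addrAC subrr add0r mul1r.
  have Ki : 0 < K%:R^-1 :> R by rewrite invr_gt0.
  have s'1 : s' <= 1 by rewrite ler_pdivrMr// mul1r ler_nat.
  have s01 : 0 <= s <= 1 by rewrite s0/=; lra.
  have [j cj] := clow m s i0 s01.
  have vary x : s <= x <= s' -> `|p j.+1 x - p j.+1 s| <= b * l.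
    move=> /andP[x1 x2]; rewrite /p !addr0 -dotB.
    apply: (@le_trans _ _ (d%:R * (B * (x - s)) * l)).
      apply: dot_norm_le => //; first exact: normr_ge0.
      move=> i; apply: (antideriv_norm_lecst x1 (antideriv_sub s0 _ (dg j.+1 i))); first lra.
      by move=> y /andP[y1 y2]; apply: gB; [rewrite !ltnS|lra].
    rewrite ler_wpM2r ?normr_ge0//; apply: le_trans dBK; rewrite mulrA ler_wpM2l//; last lra.
    by rewrite mulr_ge0// ltW.
  have p2 x : s <= x <= s' -> `|p 2 x| <= d%:R * B * l.
    move=> /andP[x1 x2]; rewrite /p addr0; apply: dot_norm_le => //; first exact: normr_ge0.
    by move=> i; apply: gB; [rewrite ltnS|lra].
  have bl : b * l = c * l - b * l by rewrite /b; lra.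
  have b01 : 0 < b <= 1 by rewrite b0 /b; lra.
  have ss : s <= s' by lra.
  have dB0 : 0 <= d%:R * B by rewrite mulr_ge0// ltW.
  have : c * l <= `|p j.+1 s| by rewrite /p addr0.
  rewrite ler_normr => /orP[pj|pj].
    apply: (oscillation_decay s0 ss s'1 b01 dB0 lam1 laml dp _ p2 dS0) => x xs.
    by have := vary x xs; rewrite ler_norml; lra.
  apply: (@oscillation_decay d j (fun k x => - p k x) s s' b (d%:R * B) l lam S
    s0 ss s'1 b01 dB0 lam1 laml (fun k => antiderivN (dp k))).
  - move=> x xs; by have := vary x xs; rewrite ler_norml; lra.
  - by move=> x xs; rewrite normrN; exact: p2.
  - rewrite (_ : (fun x => cos (- p 0%N x)) = fun x => cos (p 0%N x))//.
    by apply/funext => x; rewrite cosN.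
have -> : S 1 - S 0 = \sum_(0 <= k < K) (S (k.+1%:R / K%:R) - S (k%:R / K%:R)).
  by rewrite (telescope_sumr (fun k => S (k%:R / K%:R)))// mul0r divff// lt0r_neq0.
rewrite big_mkord; apply: le_trans (ler_norm_sum _ _ _) _.
apply: (@le_trans _ _ (\sum_(k < K) C1 / lam)).
  by apply: ler_sum => k _; exact: piece.
rewrite sumr_const card_ord -[leLHS]mulr_natl mulrA ler_wpM2r ?invr_ge0 ?(ltW lam0)//.
by rewrite lerDr.
Qed.

End CurveDecay.

(** * One-sided derivatives on the unit segment *)

Section OneSidedDerivatives.
Context (R : realType).

Local Notation nbhs01 s := (within `[(0 : R), 1] s^').

(** Every point of the segment is a limit of other points of it, so limits along this filter are
    unique and [derive01] is computed by any of them. *)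
Lemma nbhs01_proper (s : R) : 0 <= s <= 1 -> ProperFilter (nbhs01 s).
Proof.
move=> /andP[s0 s1]; apply: Build_ProperFilter_ex => P.
move=> /nbhs_ballP[e /= e0 H].
have e2 : 0 < Num.min (e / 2) (1 / 2) by rewrite lt_min !divr_gt0.
set r := Num.min _ _ in e2.
have re : r <= e / 2 by rewrite ge_min lexx.
have r2 : r <= 1 / 2 by rewrite ge_min lexx orbT.
have [s2|s2] := leP s (1 / 2).
  exists (s + r); apply: H; last by rewrite in_itv/=; lra.
    by rewrite /ball/= opprD addNKr normrN gtr0_norm//; lra.
  by rewrite -subr_eq0 addrAC subrr add0r gt_eqF.
exists (s - r); apply: H; last by rewrite in_itv/=; lra.
  by rewrite /ball/= opprB addrC subrK gtr0_norm//; lra.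
by rewrite -subr_eq0 addrAC subrr add0r oppr_eq0 gt_eqF.
Qed.

Lemma nbhs01P (s : R) (P : R -> Prop) : (\forall y \near nbhs01 s, P y) <->
  exists2 e : R, 0 < e & forall y, 0 <= y <= 1 -> y != s -> `|y - s| < e -> P y.
Proof.
split=> [/nbhs_ballP[e /= e0 H]|[e e0 H]].
  exists e => // y y01 ys ye; apply: (H y) => //.
  by rewrite /ball/= distrC.
apply/nbhs_ballP; exists e => //= y ye ys; rewrite /= in_itv/= => y01.
by apply: H => //; rewrite distrC.
Qed.

Lemma derive01_cvg (V : normedModType R) (f : R -> V) (s : R) (l : V) :
  0 <= s <= 1 -> (y - s)^-1 *: (f y - f s) @[y --> nbhs01 s] --> l ->
  derivable01 f s /\ derive01 f s = l.
Proof.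
move=> s01 H; have FF := nbhs01_proper s01.
by split; [apply/cvg_ex; exists l|apply: (cvg_lim (@norm_hausdorff _ V) H)].
Qed.

Lemma derive01_id (s : R) : 0 <= s <= 1 ->
  derivable01 (fun x : R => x) s /\ derive01 (fun x : R => x) s = 1.
Proof.
move=> s01; apply: derive01_cvg => //; apply: cvg_near_cst.
apply/nbhs01P; exists 1 => // y _ ys _.
by rewrite /GRing.scale/= mulVf// subr_eq0.
Qed.

Lemma derive01_cst (f : R -> R) (c s : R) : (forall y, 0 <= y <= 1 -> f y = c) ->
  0 <= s <= 1 -> derivable01 f s /\ derive01 f s = 0.
Proof.
move=> fc s01; apply: derive01_cvg => //; apply: cvg_near_cst.
apply/nbhs01P; exists 1 => // y y01 ys _.
by rewrite !fc// subrr scaler0.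
Qed.

Lemma smooth01_id : smooth01 (fun x : R => x).
Proof.
have d1 s : 0 <= s <= 1 -> derive01n 1 (fun x : R => x) s = 1.
  by move=> /derive01_id[].
have d2 k s : 0 <= s <= 1 -> derive01n k.+2 (fun x : R => x) s = 0.
  elim: k s => [|k IH] s s01; rewrite /derive01n iterS.
    by have [] := derive01_cst d1 s01.
  by have [] := derive01_cst IH s01.
move=> [|[|k]] s s01; first by have [] := derive01_id s01.
  by have [] := derive01_cst d1 s01.
by have [] := derive01_cst (d2 k) s01.
Qed.

(** The passage from the one-sided derivatives of the statement to [antideriv]: inside the segment,
    increments smaller than both [s] and [1 - s] stay in it, and bounded difference quotients give
    continuity up to the ends. *)
Lemma derivable01_antideriv (f : R -> R) :
  (forall s, 0 <= s <= 1 -> derivable01 f s) -> antideriv 0 1 f (derive01 f).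
Proof.
move=> df.
have H s e : 0 <= s <= 1 -> 0 < e -> exists2 r : R, 0 < r &
    forall y, 0 <= y <= 1 -> y != s -> `|y - s| < r ->
    `|derive01 f s - (y - s)^-1 * (f y - f s)| <= e.
  move=> s01 e0; have FF := nbhs01_proper s01.
  have /cvgrPdist_le/(_ e e0) := df s s01.
  by move=> /nbhs01P.
split=> [s /andP[s0 s1]|s s01].
  have s01 : 0 <= s <= 1 by lra.
  have C : h^-1 *: ((f \o shift s) (h *: (1 : R)) - f s) @[h --> 0^'] --> derive01 f s.
    apply/cvgrPdist_le => e e0; have [r r0 Hr] := H s e s01 e0.
    apply/nbhs_ballP; exists (Num.min r (Num.min s (1 - s))) => /=.
      by rewrite !lt_min r0/= s0/=; lra.
    move=> h; rewrite /ball/= sub0r normrN !lt_min => /and3P[hr hs hs1] h0.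
    have := Hr (h + s); rewrite addrK /GRing.scale/= mulr1; apply=> //.
      by move: hs hs1; rewrite !ltr_norml; lra.
    by rewrite -subr_eq0 addrK.
  apply: DeriveDef; first by apply/cvg_ex; exists (derive01 f s).
  by apply/cvg_lim => //; exact: norm_hausdorff.
apply/cvgrPdist_le => e e0; have [r r0 Hr] := H s 1 s01 ltr01.
set l := derive01 f s in Hr.
apply/nbhs_ballP; exists (Num.min r (e / (1 + `|l|))) => /=.
  by rewrite lt_min r0/= divr_gt0// ltr_pwDl.
move=> y; rewrite /ball/= lt_min distrC => /andP[yr ye]; rewrite in_itv/= => y01.
have [->|ys] := eqVneq y s; first by rewrite subrr normr0 ltW.
have ys0 : y - s != 0 by rewrite subr_eq0.
have -> : f s - f y = (y - s) * ((l - (y - s)^-1 * (f y - f s)) - l).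
  by field.
rewrite normrM; apply: (@le_trans _ _ (`|y - s| * (1 + `|l|))).
  rewrite ler_wpM2l//; apply: le_trans (ler_normB _ _) _.
  by rewrite lerD2r; exact: Hr.
by rewrite -ler_pdivlMr ?ltW// ltr_pwDl.
Qed.

Lemma cvg_row (T : Type) (F : set_system T) (d : nat) (f : T -> 'rV[R]_d) (l : 'rV[R]_d) :
  Filter F -> (forall i, f x 0 i @[x --> F] --> l 0 i) -> f x @[x --> F] --> l.
Proof.
move=> FF H; apply/cvg_ballP => e e0.
have : \forall x \near F, forall i, ball (l 0 i) e (f x 0 i).
  by apply: filter_forall => i; have /cvg_ballP/(_ e e0) := H i.
apply: filterS => x fx; split=> // i j; rewrite (ord1 i); exact: fx.
Qed.

(** Non-degeneracy differentiates a vector-valued function, whereas the estimates work with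
    coordinates. The limits agree coordinatewise by [cvg_row]. *)
Lemma derive01n_coord (d k : nat) (G : R -> 'rV[R]_d) (s : R) (i : 'I_d) :
  (forall i, smooth01 (fun x => G x 0 i)) -> 0 <= s <= 1 ->
  derive01n k G s 0 i = derive01n k (fun x => G x 0 i) s.
Proof.
move=> sG; elim: k s i => // k IH s i s01.
rewrite /derive01n !iterS.
set Gk := iter k _ G.
have FF := nbhs01_proper s01.
have H : (y - s)^-1 *: (Gk y - Gk s) @[y --> nbhs01 s] -->
    (\row_i derive01n k.+1 (fun x => G x 0 i) s : 'rV[R]_d).
  apply: cvg_row => j; rewrite mxE.
  have := sG j k s s01; apply: cvg_trans; apply: near_eq_cvg.
  apply/nbhs01P; exists 1 => // y y01 ys _; rewrite !mxE.
  by rewrite -!(IH _ j).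
by rewrite (derive01_cvg s01 H).2 mxE.
Qed.

End OneSidedDerivatives.

(** * Incidences *)

Section Incidences.
Context (R : realType).

Lemma antideriv_exists01 (h : R -> R) : has_deriv01 h ->
  exists S, antideriv 0 1 S h.
Proof.
(* [cl] is the retraction of the line onto [0, 1]; composing with it extends [h] to a function
   continuous everywhere. *)
move=> [h' [_ ch]]; pose cl (s : R) := Num.max 0 (Num.min 1 s).
have cl01 s : 0 <= cl s <= 1.
  by rewrite /cl le_max lexx/= ge_max ler01 ge_min lexx.
have clE s : 0 <= s <= 1 -> cl s = s.
  by move=> /andP[s0 s1]; rewrite /cl (min_idPr s1) (max_idPr s0).
have clL s t : `|cl s - cl t| <= `|s - t|.
  have clc x : [\/ x <= 0 /\ cl x = 0, 0 <= x <= 1 /\ cl x = x | 1 <= x /\ cl x = 1].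
    rewrite /cl; have [x1|/ltW x1] := leP x 1; last first.
      by apply: Or33; rewrite (max_idPr ler01).
    have [x0|/ltW x0] := leP x 0; first by apply: Or31.
    by apply: Or32; rewrite x0.
  have := ler_norm (s - t); have := ler_norm (t - s); rewrite (distrC t) ler_norml.
  by have [[? ->]|[? ->]|[? ->]] := clc s; have [[? ->]|[? ->]|[? ->]] := clc t; lra.
have chc : continuous (h \o cl).
  move=> s; apply/cvgrPdist_le => e e0.
  have /cvgrPdist_le/(_ e e0)/nbhs_ballP[r /= r0 H] := ch _ (cl01 s).
  apply/nbhs_ballP; exists r => //= t; rewrite /ball/= => st.
  apply: H; last by rewrite /= in_itv/= cl01.
  by rewrite /ball/=; exact: le_lt_trans (clL s t) st.
have [S dS] := antideriv_exists chc; exists S.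
have [dS1 cS1] := dS 0 1 (lexx _) (lexx _); split => // x x01.
by have := dS1 x x01; rewrite /= clE//; lra.
Qed.

Lemma antideriv_eq (F G f : R -> R) : antideriv 0 1 F f -> antideriv 0 1 G f ->
  F 1 - F 0 = G 1 - G 0.
Proof.
move=> dF dG; apply/eqP; rewrite eq_le.
by apply/andP; split; [apply: antideriv_le ler01 dF dG _|apply: antideriv_le ler01 dG dF _].
Qed.

Lemma has_deriv01_cos_dot d (m : 'I_d -> R) (v : 'I_d -> R) (u : R -> 'I_d -> R) :
  (forall i, has_deriv01 (u ^~ i)) -> has_deriv01 (fun s => cos (dot m (fun i => v i - u s i))).
Proof.
move=> du; have [f df] : has_deriv01 (fun s => dot m (fun i => v i - u s i)).
  apply: has_deriv01_sum => i; apply: has_deriv01M; first exact: has_deriv01_cst.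
  have [f df] := du i; exists (fun x => 0 + - f x).
  exact: antiderivD (antideriv_cst _ _ _) (antiderivN df).
by eexists; exact: antideriv_comp (@is_derive_cos R) df.
Qed.

Lemma incidence_le d J (T : Type) (P : seq T) (y : T -> 'I_d -> R)
    (u : R -> 'I_d -> R) (Q : T -> T -> bool) (delta D th : R) (A : nat -> R) :
  (forall i, has_deriv01 (u ^~ i)) ->
  (forall p q, Q p q -> exists a b : R, [/\ 0 <= a, a <= b, b <= 1, b - a = delta &
     forall s i, a <= s <= b -> `|(2 ^ J)%:R * (y p i - y q i - u s i)| <= 1]) ->
  0 <= D -> 0 <= th ->
  (forall (a b : {ffun 'I_d -> 'I_(2 ^ J)}) S,
     antideriv 0 1 S (fun s => cos (dot (fdiff R a b) (u s))) ->
     `|S 1 - S 0| <= D /\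
     forall j, ~~ close (2 ^ j) a b -> `|S 1 - S 0| <= D * th ^+ j.+1) ->
  (forall j, (j <= J)%N ->
     \sum_(p <- P) \sum_(q <- P) fejer (2 * 2 ^ j) (fun i => y p i - y q i - 0) <= A j) ->
  (\sum_(p <- P) \sum_(q <- P) (Q p q)%:R) * (delta * ((2 ^ J)%:R / 2) ^+ 2 ^+ d) <=
  \sum_(j < J.+1) D * th ^+ j * ((2 ^ (J - j))%:R ^+ d * A j).
Proof.
move=> du QP D0 th0 dec hA; set N := (2 ^ J)%N in QP dec *.
have /choice[S dS] : forall z : {ffun 'I_d -> 'I_N} * {ffun 'I_d -> 'I_N}, exists S,
    antideriv 0 1 S (fun s => cos (dot (fdiff R z.1 z.2) (u s))).
  move=> z; apply: antideriv_exists01.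
  have [f df] := @has_deriv01_cos_dot d (fdiff R z.1 z.2) (fun=> 0) u du.
  exists f; move: df; congr antideriv; apply/funext => s.
  rewrite -[in RHS]cosN /dot -sumrN; congr cos; apply: eq_bigr => i _.
  by rewrite sub0r mulrN.
have /choice[G dG] : forall z : T * T, exists S,
    antideriv 0 1 S (fun s => fejer N (fun i => y z.1 i - y z.2 i - u s i)).
  move=> z; apply: antideriv_exists01.
  apply: has_deriv01_sum => a; apply: has_deriv01_sum => b.
  exact: (@has_deriv01_cos_dot d (fdiff R a b) (fun i => y z.1 i - y z.2 i)).
(* The integrated Fourier expansion: by [fejer_energy] both sides are increments of antiderivatives
   of the same function of [s]. *)
have E : \sum_(p <- P) \sum_(q <- P) (G (p, q) 1 - G (p, q) 0) =
    \sum_(a : {ffun 'I_d -> 'I_N}) \sum_(b : {ffun 'I_d -> 'I_N})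
      energy P y (fdiff R a b) * (S (a, b) 1 - S (a, b) 0).
  have d1 : antideriv 0 1 (fun s => \sum_(p <- P) \sum_(q <- P) G (p, q) s)
      (fun s => \sum_(p <- P) \sum_(q <- P) fejer N (fun i => y p i - y q i - u s i)).
    by apply: antideriv_sum => p _; apply: antideriv_sum => q _; exact: (dG (p, q)).
  have d2 : antideriv 0 1 (fun s => \sum_(a : {ffun 'I_d -> 'I_N}) \sum_(b : {ffun 'I_d -> 'I_N})
        energy P y (fdiff R a b) * S (a, b) s)
      (fun s => \sum_(p <- P) \sum_(q <- P) fejer N (fun i => y p i - y q i - u s i)).
    rewrite [X in antideriv _ _ _ X](_ : _ = fun s =>
       \sum_(a : {ffun 'I_d -> 'I_N}) \sum_(b : {ffun 'I_d -> 'I_N})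
        energy P y (fdiff R a b) * cos (dot (fdiff R a b) (u s))).
      apply: antideriv_sum => a _; apply: antideriv_sum => b _.
      by apply: antiderivZ; exact: (dS (a, b)).
    by apply/funext => s; exact: fejer_energy.
  have := antideriv_eq d1 d2; rewrite -!sumrB.
  under eq_bigr do rewrite -sumrB.
  by move=> ->; apply: eq_bigr => a _; rewrite -sumrB; apply: eq_bigr => b _; rewrite mulrBr.
(* Positivity of the kernel: a pair outside [Q] contributes at least 0, and a pair in [Q] at least
   what its interval of length [delta] gives. *)
have G0 p q a b : 0 <= a -> a <= b -> b <= 1 -> 0 <= G (p, q) b - G (p, q) a.
  move=> a0 ab b1; have := antideriv_le ab (antideriv_cst a b 0) (antideriv_sub a0 b1 (dG (p, q))).
  rewrite subrr; apply=> x _; exact: fejer_ge0.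
apply: (@le_trans _ _ (\sum_(p <- P) \sum_(q <- P) (G (p, q) 1 - G (p, q) 0))).
  rewrite mulr_suml; apply: ler_sum => p _; rewrite mulr_suml; apply: ler_sum => q _.
  case Qpq : (Q p q); last by rewrite mul0r G0.
  rewrite mul1r; have [a [b [a0 ab b1 <- sab]]] := QP p q Qpq.
  have H := antideriv_le ab (antiderivZ ((N%:R / 2) ^+ 2 ^+ d) (antideriv_id a b))
    (antideriv_sub a0 b1 (dG (p, q))).
  apply: (@le_trans _ _ (G (p, q) b - G (p, q) a)).
    rewrite mulrC mulrBr; apply: H => x /andP[/ltW ax /ltW xb].
    by rewrite mulr1; apply: fejer_lower => i; apply: sab; rewrite ax.
  have h1 := G0 p q 0 a (lexx _) a0 (le_trans ab b1).
  have h2 := G0 p q b 1 (le_trans a0 ab) b1 (lexx _).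
  lra.
rewrite E.
apply: (@le_trans _ _ (\sum_(a : {ffun 'I_d -> 'I_N}) \sum_(b : {ffun 'I_d -> 'I_N})
    energy P y (fdiff R a b) * `|S (a, b) 1 - S (a, b) 0|)).
  apply: ler_sum => a _; apply: ler_sum => b _.
  by rewrite ler_wpM2l ?energy_ge0// ler_norm.
apply: (@shell_sum_le R d (energy P y) J (fun a b => `|S (a, b) 1 - S (a, b) 0|)) => //.
- by move=> m; exact: energy_ge0.
- by move=> a b; have [] := dec a b _ (dS (a, b)).
- by move=> a b j; have [_] := dec a b _ (dS (a, b)); exact.
(* At the shift 0 every cosine is 1, so the bound on kernel sums is a bound on sums of energies. *)
move=> j jJ; have := hA j jJ; rewrite (fejer_energy P y (2 * 2 ^ j) (fun=> 0)).
apply: le_trans; apply: ler_sum => a _; apply: ler_sum => b _.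
by rewrite /dot big1 ?cos0 ?mulr1// => i _; rewrite mulr0.
Qed.

End Incidences.

(** * Separated subsets of Ahlfors-David regular sets *)

Section Counting.
Context (R : realType) (n : nat).
Local Notation d := n.+1.
Local Notation V := 'rV[R]_d.
Local Notation edist := Defs.edist.

Lemma coord_le_edist (x y : V) i : `|x 0 i - y 0 i| <= edist x y.
Proof.
rewrite -sqrtr_sqr ler_wsqrtr// (bigD1 i)//= lerDl.
by rewrite sumr_ge0// => j _; exact: sqr_ge0.
Qed.

Lemma edist_le (x y : V) (r : R) : 0 <= r -> (forall i, `|x 0 i - y 0 i| <= r) ->
  edist x y <= d%:R * r.
Proof.
move=> r0 H; have dr0 : 0 <= d%:R * r by rewrite mulr_ge0.
rewrite -[leRHS]ger0_norm// -sqrtr_sqr ler_wsqrtr//.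
apply: (@le_trans _ _ (\sum_(i < d) r ^+ 2)).
  by apply: ler_sum => i _; rewrite -real_normK ?num_real// lerXn2r ?nnegrE.
rewrite sumr_const card_ord -[leLHS]mulr_natl exprMn ler_wpM2r ?sqr_ge0//.
by rewrite -natrX ler_nat expnS leq_pmulr// expn_gt0.
Qed.

Lemma open_eball (x : V) (r : R) : open (eball x r).
Proof.
rewrite (_ : eball x r = edist x @^-1` [set t | t < r])//.
apply: open_comp; last exact: open_lt.
move=> y _.
apply: (@continuous_comp _ _ _ (fun y : V => \sum_(i < d) (x 0 i - y 0 i) ^+ 2) Num.sqrt);
  last exact: sqrt_continuous.
suff : \sum_(i < d) (x 0 i - z 0 i) ^+ 2 @[z --> y] --> \sum_(i < d) (x 0 i - y 0 i) ^+ 2 by [].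
apply: cvg_big => [|i _]; first exact: add_continuous.
have c : x 0 i - z 0 i @[z --> y] --> x 0 i - y 0 i.
  by apply: cvgB; [exact: cvg_cst|exact: coord_continuous].
exact: (cvgM c c).
Qed.

Lemma measurable_eball (x : V) (r : R) : measurable (eball x r : set (borel_rV R d)).
Proof. by apply: sub_sigma_algebra; exact: open_eball. Qed.

(** Separation is read on coordinates, as cells are; comparison with Euclidean distances costs a
    factor [d]. *)
Definition separated (delta : R) (P : seq V) : Prop :=
  {in P &, forall p q : V, p != q -> exists i, delta <= `|p 0 i - q 0 i|}.

Section Regular.
Context (E : set V) (mu : {measure set (borel_rV R d) -> \bar R}) (alpha C : R).
Context (alpha0 : 0 <= alpha).
Context (C0 : 0 < C).
Context (AD : forall (x : V) (delta : R), E x -> 0 < delta <= 1 ->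
  ((C^-1 * delta `^ alpha)%:E <= mu (eball x delta) <= (C * delta `^ alpha)%:E)%E).

(** Volume packing: the balls of radius [delta / 2] about the points are disjoint and lie in the
    ball of radius [4 * d%:R * r] about [x], so the upper and lower bounds on [mu] can be compared.
    The ratio of the radii is [8 * d%:R * (r / delta)]. *)
Lemma local_count (x : V) (delta r : R) (P : seq V) :
  0 < delta -> delta <= r -> 4 * d%:R * r <= 1 -> E x -> uniq P -> {in P, forall p : V, E p} ->
  separated delta P -> {in P, forall (p : V) i, `|p 0 i - x 0 i| < r} ->
  (size P)%:R <= C ^+ 2 * (8 * d%:R) `^ alpha * (r / delta) `^ alpha.
Proof.
move=> delta0 dr r1 Ex uP PE sP Px.
have r0 : 0 < r by lra.
have d1 : 1 <= d%:R :> R by rewrite ler1n.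
have dr' : r <= d%:R * r by rewrite ler_peMl// ltW.
have trP : trivIset [set` P] (fun p : V => eball p (delta / 2)).
  apply/trivIsetP => p q pP qP pq.
  apply/seteqP; split => // y [yp yq].
  have [i di] := sP p q pP qP pq.
  have := le_lt_trans (coord_le_edist p y i) yp.
  have := le_lt_trans (coord_le_edist q y i) yq.
  by move: di; rewrite !ltr_norml ler_normr => /orP[]; lra.
have H : (\sum_(p <- P) mu (eball p (delta / 2)) <= (C * (4 * d%:R * r) `^ alpha)%:E)%E.
  apply: (@le_trans _ _ (mu (eball x (4 * d%:R * r)))); last first.
    have r01 : 0 < 4 * d%:R * r <= 1 by rewrite r1 andbT !mulr_gt0.
    by have /andP[] := AD Ex r01.
  rewrite fsbig_seq// -(measure_fin_bigcup mu (finite_seq P) trP); last first.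
    by move=> p _; exact: measurable_eball.
  apply: le_measure; rewrite ?inE.
  - by apply: fin_bigcup_measurable; [exact: finite_seq|move=> p _; exact: measurable_eball].
  - exact: measurable_eball.
  move=> y [p pP yp].
  apply: (@le_lt_trans _ _ (d%:R * (2 * r))); last first.
    by rewrite mulrCA -mulrA ltr_pM2r ?mulr_gt0//; lra.
  apply: edist_le; first by lra.
  move=> i; have := Px p pP i; have := le_lt_trans (coord_le_edist p y i) yp.
  rewrite !ltr_norml ler_norml; lra.
have {}H : (size P)%:R * (C^-1 * (delta / 2) `^ alpha) <= C * (4 * d%:R * r) `^ alpha.
  rewrite -lee_fin; apply: le_trans H.
  rewrite (_ : _%:E = \sum_(p <- P) (C^-1 * (delta / 2) `^ alpha)%:E)%E; last first.
    by rewrite sumEFin big_const_seq count_predT iter_addr_0 mulr_natl.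
  rewrite big_seq [leRHS]big_seq; apply: lee_sum => p pP.
  have d01 : 0 < delta / 2 <= 1 by rewrite divr_gt0//=; lra.
  by have /andP[] := AD (PE p pP) d01.
move: H; rewrite mulrCA -(ler_pM2l C0) mulVKf ?lt0r_neq0// => H.
have e1 : (4 * d%:R * r) `^ alpha =
    (8 * d%:R) `^ alpha * (r / delta) `^ alpha * (delta / 2) `^ alpha.
  rewrite -!powRM ?mulr_ge0 ?divr_ge0 ?invr_ge0 ?ltW//.
  by congr (_ `^ _); field; exact: lt0r_neq0.
have d20 : 0 < (delta / 2) `^ alpha by rewrite powR_gt0// divr_gt0.
by rewrite -(ler_pM2r d20); apply: le_trans H _; rewrite e1 expr2 !mulrA.
Qed.

Context (E_compact : compact E).

(** Regularity speaks only of radii at most 1. For [r] at least [r0], compactness covers [E] by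
    finitely many balls of radius [r0], whose number enters [K], and no localisation of [P] is
    required. *)
Lemma regular_count : exists (K r0 : R), [/\ 0 < K, 0 < r0 &
  forall (delta r : R) (P : seq V), 0 < delta -> delta <= r0 -> delta <= r ->
    uniq P -> {in P, forall p : V, E p} -> separated delta P ->
    r0 <= r \/ (exists2 x, E x & {in P, forall (p : V) i, `|p 0 i - x 0 i| < r}) ->
    (size P)%:R <= K * (r / delta) `^ alpha].
Proof.
pose r0 : R := (4 * d%:R)^-1.
have r00 : 0 < r0 by rewrite invr_gt0 mulr_gt0.
pose K1 := C ^+ 2 * (8 * d%:R) `^ alpha.
have K10 : 0 < K1 by rewrite mulr_gt0 ?exprn_gt0// powR_gt0// mulr_gt0.
have [D DE Dcov] : finite_subset_cover E (fun x => eball x r0) E.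
  move: E_compact; rewrite compact_cover; apply; first by move=> x _; exact: open_eball.
  move=> x Ex; exists x => //; rewrite /eball/= (_ : Defs.edist x x = 0)//.
  by rewrite /Defs.edist big1 ?sqrtr0// => i _; rewrite subrr expr0n.
pose s : seq V := finmap.enum_fset D.
exists (K1 * (1 + (size s)%:R)), r0; split => //; first by rewrite mulr_gt0// ltr_pwDl.
move=> delta r P delta0 dr0 dr uP PE sP.
have sub (Q : pred V) : uniq [seq p <- P | Q p] /\ {in [seq p <- P | Q p], forall p : V, E p} /\
    separated delta [seq p <- P | Q p].
  split; first exact: filter_uniq.
  split=> [p|p q]; rewrite !mem_filter => /andP[_ pP]; first exact: PE.
  by move=> /andP[_ qP]; exact: sP.
have bnd (x : V) (r' : R) (Q : seq V) : delta <= r' -> r' <= r0 -> E x -> uniq Q ->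
    {in Q, forall p : V, E p} -> separated delta Q ->
    {in Q, forall (p : V) i, `|p 0 i - x 0 i| < r'} -> (size Q)%:R <= K1 * (r' / delta) `^ alpha.
  move=> dr' rr' Ex uQ QE sQ Qx; apply: (local_count delta0 dr' _ Ex uQ QE sQ Qx).
  by rewrite -ler_pdivlMl ?mulr_gt0// mulr1.
have mono (r1 r2 : R) : 0 <= r1 -> r1 <= r2 -> (r1 / delta) `^ alpha <= (r2 / delta) `^ alpha.
  move=> r10 r12; rewrite ge0_ler_powR ?nnegrE ?divr_ge0 ?(ltW delta0)//; first by lra.
  by rewrite ler_wpM2r ?invr_ge0 ?(ltW delta0).
have A0 : 0 <= (r / delta) `^ alpha by exact: powR_ge0.
case: (leP r0 r) => [r0r _|rr0 []]; last 2 first.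
- by [].
- move=> [x Ex Px]; have := bnd x r P dr (ltW rr0) Ex uP PE sP Px.
  move=> /le_trans; apply; rewrite ler_wpM2r// ler_peMr ?(ltW K10)//.
  by rewrite lerDl.
have : (size P <= \sum_(x <- s) size [seq p <- P | `[< eball x r0 p >]])%N.
  rewrite -[leqLHS]sum1_size; under [leqRHS]eq_bigr do rewrite -sum1_size big_filter.
  under [leqRHS]eq_bigr do rewrite big_mkcond/=.
  rewrite [leqRHS]exchange_big/= big_seq [leqRHS]big_seq; apply: leq_sum => p pP.
  have [x xD px] := Dcov p (PE p pP).
  have xs : x \in s by [].
  by rewrite (big_rem x)//= asboolT.
rewrite -(ler_nat R) natr_sum => /le_trans; apply.
apply: (@le_trans _ _ (\sum_(x <- s) K1 * (r0 / delta) `^ alpha)).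
  rewrite big_seq [leRHS]big_seq; apply: ler_sum => x xs.
  have [uQ [QE sQ]] := sub (fun p => `[< eball x r0 p >]).
  apply: (bnd x) => //; first by have := DE x xs; rewrite inE.
  move=> p; rewrite mem_filter => /andP[/asboolP px _] i; rewrite distrC.
  exact: le_lt_trans (coord_le_edist x p i) px.
rewrite big_const_seq count_predT iter_addr_0 -[leLHS]mulr_natl.
have := mono _ _ (ltW r00) r0r; rewrite -(ler_pM2l K10) => h.
apply: le_trans (ler_wpM2l (ler0n _ _) h) _.
rewrite mulrA [_ * K1]mulrC ler_wpM2r// ler_wpM2l ?(ltW K10)//.
by rewrite lerDr.
Qed.

(** A separated subset of largest size exists by the bound [K]; a point of [E] far from all its
    elements could be adjoined. *)
Lemma maximal_separated (delta : R) : 0 < delta -> (exists K : nat, forall P : seq V, uniq P ->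
    {in P, forall p : V, E p} -> separated delta P -> (size P <= K)%N) ->
  exists P : seq V, [/\ uniq P, {in P, forall p : V, E p}, separated delta P &
    forall x, E x -> exists2 p, p \in P & forall i, `|x 0 i - p 0 i| < delta].
Proof.
move=> delta0 [K PK].
pose good (P : seq V) := [/\ uniq P, {in P, forall p : V, E p} & separated delta P].
pose Q k := `[< exists2 P, good P & size P = k >].
have exQ : exists k, Q k by exists 0%N; apply/asboolP; exists [::].
have QK k : Q k -> (k <= K)%N by move=> /asboolP[P [uP PE sP] <-]; exact: PK.
case: (ex_maxnP exQ QK) => k /asboolP[P [uP PE sP] <-] Pmax.
exists P; split => // x Ex; apply: contrapT => /forall2NP far.
have far' p : p \in P -> exists i, delta <= `|x 0 i - p 0 i|.
  move=> pP; case: (far p) => [//|/existsNP[i hi]].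
  by exists i; rewrite leNgt; apply/negP.
have : Q (size (x :: P)).
  apply/asboolP; exists (x :: P) => //; split.
  - rewrite /= uP andbT; apply/negP => xP; have [k'] := far' x xP.
    by rewrite subrr normr0; lra.
  - by move=> p; rewrite inE => /predU1P[->|/PE].
  - move=> p q; rewrite !inE => /predU1P[->|pP] /predU1P[->|qP].
    + by rewrite eqxx.
    + by move=> _; exact: far'.
    + by move=> _; have [k' hk] := far' p pP; exists k'; rewrite distrC.
    + exact: sP.
by move=> /Pmax /=; rewrite ltnn.
Qed.

End Regular.
End Counting.

(** * Minkowski dimension *)

Section MinkowskiDimension.
Context (R : realType).

Lemma covering_number_antitone (m : nat) (A : set 'rV[R]_m) (d1 d2 : R) : d1 <= d2 ->
  (covering_number A d2 <= covering_number A d1)%E.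
Proof.
move=> d12; apply: ereal_inf_le_tmp => _ [c cA <-]; exists c => //.
move=> x /cA[y yc yx]; exists y => //; exact: lt_le_trans d12.
Qed.

Lemma upper_minkowski_dim_le (m : nat) (A : set 'rV[R]_m) (K beta r0 : R) :
  0 < K -> 0 < r0 ->
  (forall r, 0 < r < r0 -> (covering_number A r <= (K * r^-1 `^ beta)%:E)%E) ->
  (upper_minkowski_dim A <= beta%:E)%E.
Proof.
move=> K0 r00 H; apply/lee_addgt0Pr => e e0.
(* For [r < expR (- L0)] the logarithm of [r^-1] exceeds [L0], so the term [ln K / ln r^-1] is at
   most [e]; the summand 1 keeps this logarithm positive. *)
pose L0 : R := `|ln K| / e + 1.
have L00 : 0 < L0 by rewrite ltr_pwDr// divr_ge0// ltW.
pose r1 := Num.min r0 (expR (- L0)).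
have r10 : 0 < r1 by rewrite lt_min r00 expR_gt0.
apply: (@le_trans _ _ (ereal_sup ((fun delta : R =>
    (lne (covering_number A delta) / (ln delta^-1)%:E)%E) @` [set r | 0 < r < r1]))).
  apply: ereal_inf_lbound; exists [set r | 0 < r < r1] => //.
  near=> r => /=; apply/andP; split; near: r; [exact: nbhs_right_gt|exact: nbhs_right_lt].
apply: ge_ereal_sup => _ [r /= /andP[rpos rr1] <-].
have rV0 : 0 < r^-1 by rewrite invr_gt0.
have rr0 : 0 < r < r0 by rewrite rpos (lt_le_trans rr1)// ge_min lexx.
have L0r : L0 < ln r^-1.
  rewrite lnV ?posrE// ltrNr -[X in _ < X]expRK ltr_ln ?posrE ?expR_gt0//.
  by apply: lt_le_trans rr1 _; rewrite ge_min lexx orbT.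
set L := ln r^-1 in L0r *.
have Lpos : 0 < L by lra.
have h1 : (lne (covering_number A r) <= (ln K + beta * L)%:E)%E.
  apply: (@le_trans _ _ (lne (K * r^-1 `^ beta)%:E)).
    have Kr0 : 0 < K * r^-1 `^ beta by rewrite mulr_gt0// powR_gt0.
    rewrite lee_lne ?in_itv/= ?leey ?lee_fin ?(ltW Kr0)//; first exact: H.
    rewrite andbT; apply: le_ereal_inf_tmp => _ [c _ <-].
    by rewrite lee_fin.
  rewrite lne_EFin ?mulr_gt0 ?powR_gt0// lnM ?posrE ?powR_gt0// ln_powR//.
have h2 : ((L%:E)^-1 = (L^-1)%:E)%E by rewrite inver gt_eqF.
rewrite h2.
have LV0 : (0 <= (L^-1)%:E)%E by rewrite lee_fin invr_ge0 ltW.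
apply: le_trans (lee_wpmul2r LV0 h1) _.
rewrite -EFinM -EFinD lee_fin mulrDl mulfK ?lt0r_neq0// addrC lerD2l.
rewrite ler_pdivrMr// mulrC -ler_pdivrMr//.
apply: le_trans (ltW L0r); rewrite /L0.
have : ln K / e <= `|ln K| / e by rewrite ler_wpM2r ?ler_norm// invr_ge0 ltW.
lra.
Unshelve. all: by end_near. Qed.
End MinkowskiDimension.

(** * Powers, geometric sums, bounded coordinates and the derivatives of the curve *)

Section Preparation.
Context (R : realType).

Lemma powR_exprn (x a : R) (k : nat) : 0 <= x -> (x ^+ k) `^ a = (x `^ a) ^+ k.
Proof.
move=> x0; elim: k => [|k IH]; first by rewrite !expr0 powR1.
by rewrite !exprS powRM ?exprn_ge0// IH.
Qed.

Lemma exists_root (x : R) (k : nat) : (0 < k)%N -> 0 < x ->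
  (x `^ k%:R^-1) ^+ k = x.
Proof.
move=> k0 x0; rewrite -powR_mulrn ?powR_ge0// -powRrM mulVf ?powRr1 ?ltW//.
by rewrite pnatr_eq0 -lt0n.
Qed.

Lemma powR_gt1 (x a : R) : 1 < x -> 0 < a -> 1 < x `^ a.
Proof.
move=> x1 a0; rewrite /powR gt_eqF; last by lra.
by rewrite expR_gt1 mulr_gt0// ln_gt0.
Qed.

Lemma geometric_le (q : R) (n : nat) : 0 <= q -> q < 1 ->
  \sum_(j < n) q ^+ j <= (1 - q)^-1.
Proof.
move=> q0 q1; have q10 : 0 < 1 - q by lra.
rewrite -(ler_pM2l q10) mulfV ?lt0r_neq0//.
have := subrX1 q n; have : 0 <= q ^+ n by rewrite exprn_ge0.
lra.
Qed.

Lemma mx_coord_le (m : nat) (x : 'rV[R]_m) i : `|x 0 i| <= `|x|.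
Proof.
rewrite [leRHS]/Num.norm/= mx_normrE.
by apply: (le_trans _ (le_bigmax _ _ (0, i))).
Qed.

Lemma compact_coord_bounded (n : nat) (E : set 'rV[R]_n.+1) : compact E ->
  exists2 D : R, 0 <= D & forall x y i, E x -> E y -> `|x 0 i - y 0 i| <= D.
Proof.
move=> /compact_bounded[M [_ HM]]; pose D := `|M| + 1.
have MD : M < D by rewrite /D; have := ler_norm M; lra.
have D0 : 0 <= D by rewrite addr_ge0.
exists (D + D); first by rewrite addr_ge0.
move=> x y i Ex Ey; apply: le_trans (ler_normB _ _) _.
by apply: lerD; apply: le_trans (mx_coord_le _ _) _; exact: HM MD _ _.
Qed.

Section Curve.
Context (n : nat) (gamma : 'I_n -> R -> R).
Context (gamma_smooth : forall l : 'I_n, smooth01 (gamma l)).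
Context (gamma_nondeg : nondegenerate_curve (curve_param gamma)).

Definition curve_deriv (k : nat) (i : 'I_n.+1) : R -> R :=
  derive01n k (fun x => curve_param gamma x 0 i).

Lemma curve_coord_smooth i : smooth01 (fun x => curve_param gamma x 0 i).
Proof.
case: (unliftP ord0 i) => [l|] ->.
  rewrite (_ : (fun x => _) = gamma l)//; apply/funext => x.
  by rewrite mxE liftK.
rewrite (_ : (fun x => _) = fun x => x); first exact: smooth01_id.
by apply/funext => x; rewrite mxE unlift_none.
Qed.

Lemma curve_deriv_antideriv k i : antideriv 0 1 (curve_deriv k i) (curve_deriv k.+1 i).
Proof.
apply: derivable01_antideriv => s s01; exact: (@curve_coord_smooth i k s s01).
Qed.

Lemma curve_deriv_det (s : R) : 0 <= s <= 1 ->
  \det (\matrix_(j < n.+1, i < n.+1) curve_deriv j.+1 i s) != 0.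
Proof.
move=> s01; have := gamma_nondeg s01; rewrite row_free_unit unitmxE unitfE.
congr (\det _ != 0); apply/matrixP => j i; rewrite !mxE.
exact: (derive01n_coord _ _ curve_coord_smooth s01).
Qed.

End Curve.

End Preparation.

(** * Covering the configuration set *)

Section Covering.
Context (R : realType) (n : nat).
Local Notation d := n.+1.
Local Notation V := 'rV[R]_d.
Context (gamma : 'I_n -> R -> R) (E : set V).
Context (gamma_smooth : forall l : 'I_n, smooth01 (gamma l)).
Context (gamma_nondeg : nondegenerate_curve (curve_param gamma)).
Context (E_compact : compact E).
Context (mu : {measure set (borel_rV R d) -> \bar R}) (alpha C : R).
Context (C0 : 0 < C).
Context (AD : forall (x : V) (delta : R), E x -> 0 < delta <= 1 ->
  ((C^-1 * delta `^ alpha)%:E <= mu (eball x delta) <= (C * delta `^ alpha)%:E)%E).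
Context (alpha_gt : d%:R - d%:R^-1 < alpha).

Lemma alpha_ge0 : 0 <= alpha.
Proof.
apply: le_trans (ltW alpha_gt); rewrite subr_ge0.
by apply: (@le_trans _ _ 1); rewrite ?invf_le1 ?ler1n ?ltr0n.
Qed.

Let g := curve_deriv gamma.

(** A pair that is not close at scale 2^j has a coordinate difference of at least 2^j, so
    [curve_decay] applies with lam = (kappa 2^j)^(1/d), the translation [w] going into the constant
    phase. The extra factor [th] in the constant pays for the exponent [j.+1]. *)
Lemma decay_dyadic (kappa : R) : 0 < kappa ->
  exists2 D : R, 0 < D & forall J (w : 'I_d -> R) (a b : {ffun 'I_d -> 'I_(2 ^ J)}) (S : R -> R),
    antideriv 0 1 S (fun s => cos (dot (fdiff R a b) (fun i => kappa * (w i + g 0 i s)))) ->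
    `|S 1 - S 0| <= D /\
    forall j, ~~ close (2 ^ j) a b -> `|S 1 - S 0| <= D * (2 `^ d%:R^-1)^-1 ^+ j.+1.
Proof.
move=> kappa0.
have [Cd Cd0 decay] := curve_decay (curve_deriv_antideriv gamma_smooth)
  (curve_deriv_det gamma_smooth gamma_nondeg).
set th := 2 `^ d%:R^-1; set kd := kappa `^ d%:R^-1.
have th0 : 0 < th by rewrite powR_gt0.
have kd0 : 0 < kd by rewrite powR_gt0.
have CC0 : 0 < Cd / kd * th by rewrite mulr_gt0// divr_gt0.
exists (1 + Cd / kd * th); first by rewrite ltr_pwDl// ltW.
move=> J w a b S dS; split.
  apply: le_trans (cos_antideriv_le ler01 dS) _; lra.
move=> j; rewrite negb_forall => /existsP[i1 far].
pose m i := kappa * fdiff R a b i.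
have [i0 _ /(_ _ isT) mi0] := arg_maxP (fun i => `|m i|) (isT : xpredT i1).
have big : kappa * 2 ^+ j <= `|m i0|.
  apply: le_trans (mi0 i1); rewrite normrM (gtr0_norm kappa0) ler_wpM2l ?(ltW kappa0)//.
  rewrite /fdiff -natrX ler_normr.
  move: far; rewrite negb_and -!leqNgt -!(ler_nat R) !natrD => /orP[]; lra.
have lam0 : 0 < kd * th ^+ j by rewrite mulr_gt0// exprn_gt0.
have lamd : (kd * th ^+ j) ^+ d <= `|m i0|.
  by rewrite exprMn exprAC !exists_root.
have dS' : antideriv 0 1 S (fun s => cos (dot m (fun i => g 0 i s) + dot m w)).
  move: dS; congr antideriv; apply/funext => s; congr cos.
  by rewrite /dot -big_split/=; apply: eq_bigr => i _; rewrite /m; ring.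
have := decay m _ i0 _ S lam0 lamd mi0 dS'.
move=> /le_trans; apply.
have -> : Cd / (kd * th ^+ j) = Cd / kd * th * th^-1 ^+ j.+1.
  rewrite exprS exprVn; field; rewrite !lt0r_neq0// exprn_gt0//.
rewrite ler_wpM2r ?exprn_ge0 ?invr_ge0 ?(ltW th0)//; lra.
Qed.

Lemma shell_ratio_lt1 : (2 `^ d%:R^-1)^-1 * 2 ^+ d / 2 `^ alpha < 1 :> R.
Proof.
rewrite ltr_pdivrMr ?powR_gt0// mul1r ltr_pdivrMl ?powR_gt0//.
rewrite -powR_mulrn// -powRD; last by apply/implyP.
rewrite -subr_gt0.
have e0 : 0 < d%:R^-1 + alpha - d%:R :> R.
  by rewrite subr_gt0 addrC -ltrBlDr.
have := powR_gt1 (ltr1n R 2) e0.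
rewrite powRB; last by apply/implyP.
by rewrite ltr_pdivlMr ?powR_gt0// mul1r subr_gt0.
Qed.

Context (t : 'rV[R]_n).

Definition shift (i : 'I_d) : R := if unlift ord0 i is Some l then t 0 l else 0.

Lemma configuration_coord (x y : V) : E x -> E y -> 0 <= x 0 ord0 - y 0 ord0 <= 1 ->
  (forall l : 'I_n, phi gamma l x y = t 0 l) ->
  exists2 s : R, 0 <= s <= 1 & forall i, x 0 i - y 0 i = shift i + g 0 i s.
Proof.
move=> Ex Ey s01 H; exists (x 0 ord0 - y 0 ord0) => // i.
rewrite /shift /g /curve_deriv /= mxE; case: (unliftP ord0 i) => [l|] ->.
  by rewrite -H /phi subrK.
by rewrite add0r.
Qed.

(** The interval starts or ends at [s], on the side where [0, 1] has room, because [s] may be an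
    endpoint. *)
Lemma segment_around (s delta : R) : 0 <= s <= 1 -> 0 <= delta <= 2^-1 ->
  exists a b : R, [/\ 0 <= a, a <= b, b <= 1, b - a = delta &
    forall x, a <= x <= b -> `|x - s| <= delta].
Proof.
move=> s01 d01; have [h|h] := leP s (2^-1).
  exists s, (s + delta); split; rewrite ?lerDl; try lra.
  by move=> x xs; rewrite ler_norml; lra.
exists (s - delta), s; split; try lra.
by move=> x xs; rewrite ler_norml; lra.
Qed.

Lemma configuration_cover : exists K c : R, [/\ 0 < K, 0 < c &
  forall J : nat, (covering_number (configuration_set gamma E t) (c / 2 ^+ J) <=
    (K * (2 ^+ J) `^ (2 * alpha - n%:R))%:E)%E].
Proof.
have [K [r0 [K0 r00 count]]] := regular_count alpha_ge0 C0 AD E_compact.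
have [Db Db0 EDb] := compact_coord_bounded E_compact.
(* Rescaling by [kappa] brings coordinate differences of points of [E] into [-1, 1], within one
   period of the kernel, as [fejer_sum_le] requires. *)
pose kappa := (Db + 1)^-1.
have kappa0 : 0 < kappa by rewrite invr_gt0 ltr_pwDr.
have kD : kappa * Db <= 1 by rewrite ler_pdivrMl ?ltr_pwDr//; lra.
have [D D0 decay] := decay_dyadic kappa0.
have [B B0 gB] := curve_bounded (curve_deriv_antideriv gamma_smooth) 1.
set th := (2 `^ d%:R^-1)^-1 in decay.
have th0 : 0 < th by rewrite invr_gt0 powR_gt0.
have kB0 : 0 < kappa * (2 + B) by rewrite mulr_gt0// addr_gt0.
(* The three bounds serve [segment_around], [regular_count], and the condition that N times the
   rescaled deviation from the curve be at most 1. *)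
pose c0 := Num.min 2^-1 (Num.min r0 (kappa * (2 + B))^-1).
have c00 : 0 < c0 by rewrite !lt_min !invr_gt0 kB0 r00 ltr0n.
have c02 : c0 <= 2^-1 by rewrite ge_min lexx.
have c0r : c0 <= r0 by rewrite !ge_min lexx orbT.
have c0k : c0 * (kappa * (2 + B)) <= 1.
  by rewrite -ler_pdivlMr// mul1r !ge_min lexx !orbT.
have c0k2 : c0 * (kappa * 2) <= 1.
  apply: le_trans c0k; rewrite !ler_wpM2l ?(ltW c00) ?(ltW kappa0)//.
  by rewrite lerDl ltW.
pose q := th * 2 ^+ d / 2 `^ alpha.
have q0 : 0 <= q by rewrite divr_ge0 ?mulr_ge0 ?exprn_ge0 ?powR_ge0 ?(ltW th0).
have q1 : q < 1 := shell_ratio_lt1.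
have q1' : 0 < 1 - q by lra.
(* [W] gathers the factors of a shell that depend neither on [j] nor on [J], and [W2] is the
   constant in the bound on the size of [P]. In [K1], the factor [4 ^+ d] comes from the lower bound
   (N/2)^(2d) of the kernel and [c0] from the length [delta]. *)
pose W := D * K * (kappa * 2 * c0)^-1 `^ alpha * (81 * pi * 4) ^+ d.
have W0 : 0 <= W.
  by rewrite /W !mulr_ge0 ?powR_ge0 ?exprn_ge0 ?mulr_ge0 ?mulr_ge0 ?pi_ge0 ?(ltW D0) ?(ltW K0)//.
pose W2 := K * (r0 / c0) `^ alpha.
have W20 : 0 < W2 by rewrite mulr_gt0// powR_gt0// divr_gt0.
pose K1 := W * W2 / (1 - q) * 4 ^+ d / c0.
have K10 : 0 <= K1.
  rewrite /K1 divr_ge0 ?(ltW c00)// mulr_ge0 ?exprn_ge0// divr_ge0 ?(ltW q1')//.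
  exact: mulr_ge0 W0 (ltW W20).
exists (K1 + 1), ((n + d).+2%:R * c0); split; first by rewrite ltr_pwDr.
  by rewrite mulr_gt0.
move=> J; pose N : R := 2 ^+ J; rewrite -/N.
have N1 : 1 <= N by rewrite exprn_ege1// ler1n.
have N0 : 0 < N by lra.
have NE : (2 ^ J)%:R = N by rewrite natrX.
pose delta := c0 / N; pose T := N `^ alpha.
have T0 : 0 < T by rewrite powR_gt0.
have delta0 : 0 < delta by rewrite divr_gt0.
have dc0 : delta <= c0 by rewrite ler_pdivrMr// ler_peMr// ltW.
have dr0 : delta <= r0 by apply: le_trans c0r.
have sizeP (P : seq V) : uniq P -> {in P, forall p : V, E p} -> separated delta P ->
    (size P)%:R <= W2 * T.
  move=> uP PE sP; have := count delta r0 P delta0 dr0 dr0 uP PE sP (or_introl (lexx _)).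
  have -> : r0 / delta = r0 / c0 * N.
    by rewrite /delta; field; rewrite (lt0r_neq0 N0) (lt0r_neq0 c00).
  by rewrite powRM ?(ltW N0) ?divr_ge0 ?(ltW r00) ?(ltW c00)// mulrA.
have [P [uP PE sP Pmax]] : exists P : seq V,
    [/\ uniq P, {in P, forall p : V, E p}, separated delta P &
    forall x, E x -> exists2 p, p \in P & forall i, `|x 0 i - p 0 i| < delta].
  apply: maximal_separated => //; exists (Num.truncn (W2 * T)) => P uP PE sP.
  by rewrite truncn_ge_nat ?sizeP// mulr_ge0// ltW.
pose y (p : V) i := kappa * p 0 i.
pose u (s : R) i := kappa * (shift i + g 0 i s).
(* The tolerance is [2 * delta] because both points of a configuration are moved by less than
   [delta] per coordinate. *)
pose Q (p q : V) := `[< exists2 s : R, 0 <= s <= 1 &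
   forall i, `|p 0 i - q 0 i - (shift i + g 0 i s)| <= 2 * delta >].
have du i : has_deriv01 (u ^~ i).
  exists (fun s => kappa * (0 + g 1 i s)); apply: antiderivZ; apply: antiderivD.
    exact: antideriv_cst.
  exact: curve_deriv_antideriv.
have QP p q' : Q p q' -> exists a b : R, [/\ 0 <= a, a <= b, b <= 1, b - a = delta &
     forall s i, a <= s <= b -> `|(2 ^ J)%:R * (y p i - y q' i - u s i)| <= 1].
  move=> /asboolP[s s01 Hs].
  have d01 : 0 <= delta <= 2^-1 by rewrite ltW//= (le_trans dc0).
  have [a [b [a0 ab b1 ba sab]]] := segment_around s01 d01.
  exists a, b; split => // x i xab.
  have lip : `|g 0 i x - g 0 i s| <= B * delta.
    have x01 : 0 <= x <= 1 by lra.
    have gB1 x' : 0 <= x' <= 1 -> `|g 1 i x'| <= B by exact: gB.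
    apply: le_trans (antideriv_lipschitz (curve_deriv_antideriv gamma_smooth 0 i) gB1 x01 s01) _.
    by rewrite ler_wpM2l ?(ltW B0) ?sab.
  have e : N * (y p i - y q' i - u x i) =
      N * kappa * ((p 0 i - q' 0 i - (shift i + g 0 i s)) - (g 0 i x - g 0 i s)).
    by rewrite /y /u; ring.
  rewrite NE e normrM gtr0_norm ?mulr_gt0//.
  apply: (@le_trans _ _ (N * kappa * (2 * delta + B * delta))).
    rewrite ler_wpM2l ?mulr_ge0 ?(ltW N0) ?(ltW kappa0)//.
    by apply: le_trans (ler_normB _ _) _; rewrite lerD.
  have -> : N * kappa * (2 * delta + B * delta) = c0 * (kappa * (2 + B)).
    by rewrite /delta; field; exact: lt0r_neq0.
  exact: c0k.
have dec (a b : {ffun 'I_d -> 'I_(2 ^ J)}) S :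
     antideriv 0 1 S (fun s => cos (dot (fdiff R a b) (u s))) ->
     `|S 1 - S 0| <= D /\
     forall j, ~~ close (2 ^ j) a b -> `|S 1 - S 0| <= D * th ^+ j.+1.
  exact: (decay J shift a b S).
(* For each fixed p, a cell of side 1/M in rescaled coordinates, M = 2 * 2^j, has side
   [(kappa * M)^-1] in the original ones; [regular_count] bounds the points of [P] in it. *)
pose A j : R := (size P)%:R * (K * ((kappa * (2 * 2 ^ j)%:R)^-1 / delta) `^ alpha *
   (81 * pi * (2 * 2 ^ j)%:R ^+ 2) ^+ d).
have hA j : (j <= J)%N ->
     \sum_(p <- P) \sum_(q <- P) fejer (2 * 2 ^ j) (fun i => y p i - y q i - 0) <= A j.
  move=> jJ; set M := (2 * 2 ^ j)%N.
  have ME : M%:R = 2 * 2 ^+ j :> R by rewrite /M natrM natrX.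
  have M0 : 0 < M%:R :> R by rewrite ME mulr_gt0// exprn_gt0.
  have kM0 : 0 < kappa * M%:R by rewrite mulr_gt0.
  have dr : delta <= (kappa * M%:R)^-1.
    rewrite -[leRHS]mul1r ler_pdivlMr// /delta mulrAC ler_pdivrMr// mul1r ME.
    rewrite [leLHS](_ : _ = c0 * (kappa * 2) * 2 ^+ j); last by ring.
    apply: (@le_trans _ _ (1 * 2 ^+ j)); first by rewrite ler_wpM2r// exprn_ge0.
    by rewrite mul1r ler_weXn2l// ler1n.
  set Bj := K * ((kappa * M%:R)^-1 / delta) `^ alpha.
  have Bj0 : 0 <= Bj by rewrite mulr_ge0 ?powR_ge0 ?(ltW K0).
  apply: (@le_trans _ _ (\sum_(p <- P) Bj * (81 * pi * M%:R ^+ 2) ^+ d)); last first.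
    by rewrite big_const_seq count_predT iter_addr_0 -[leLHS]mulr_natl.
  rewrite big_seq [leRHS]big_seq; apply: ler_sum => p pP.
  pose v (q' : V) i : R := y p i - y q' i - 0.
  have v1 : {in P, forall q' i, `|v q' i| <= 1}.
    move=> q' qP i; rewrite /v /y subr0 -mulrBr normrM gtr0_norm//.
    by apply: le_trans kD; rewrite ler_wpM2l ?(ltW kappa0)//; apply: EDb; exact: PE.
  apply: (fejer_sum_le (v := v) v1) => k.
  set P' := [seq _ <- P | _].
  have [->|[qc qcP]] : P' = [::] \/ exists qc, qc \in P'.
    by case: (P') => [|qc s]; [left|right; exists qc; rewrite mem_head].
    by [].
  have sub q' : q' \in P' -> q' \in P /\ cell M (v q') = k.
    by rewrite mem_filter => /andP[/eqP].
  apply: (count delta _ P' delta0 dr0 dr).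
  - exact: filter_uniq.
  - by move=> q' /sub[/PE].
  - by move=> x1 x2 /sub[h1 _] /sub[h2 _]; exact: sP.
  right; exists qc; first by have [/PE] := sub _ qcP.
  move=> q' qP i; have [qP' qk] := sub _ qP; have [qcP' qck] := sub _ qcP.
  have := cell_eq (v1 _ qP' i) (v1 _ qcP' i) (etrans qk (esym qck)).
  rewrite (_ : v q' i - v qc i = - (kappa * (q' 0 i - qc 0 i))); last by rewrite /v /y; ring.
  rewrite normrN normrM gtr0_norm// -[X in _ -> _ < X]mul1r ltr_pdivlMr//.
  by rewrite (mulrC kappa M%:R) mulrCA (mulrC kappa) !mulrA [`|_| * _]mulrC.
have main := incidence_le du QP (ltW D0) (ltW th0) dec hA.
set X := \sum_(p <- P) \sum_(q <- P) (Q p q)%:R in main.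
(* With z = 2^j the powers combine as (N/z)^d * z^(2d) * z^(-alpha) = N^d * z^(d - alpha), which
   together with [th ^+ j] gives [q ^+ j]. *)
have term j : (j <= J)%N -> D * th ^+ j * ((2 ^ (J - j))%:R ^+ d * A j) =
    W * (size P)%:R * T * N ^+ d * q ^+ j.
  move=> jJ; pose z : R := 2 ^+ j; have z0 : 0 < z by rewrite exprn_gt0.
  have e1 : (2 ^ (J - j))%:R = N / z :> R.
    by rewrite natrX /N /z -[in RHS](subnK jJ) exprD mulfK// lt0r_neq0.
  have e2 : (2 * 2 ^ j)%:R = 2 * z :> R by rewrite natrM natrX.
  have zV : z^-1 `^ alpha = ((2 `^ alpha) ^+ j)^-1.
    by rewrite -(powR_inv1 (ltW z0)) -powRrM mulN1r powRN /z powR_exprn.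
  have e3 : ((kappa * (2 * z))^-1 / delta) `^ alpha =
      (kappa * 2 * c0)^-1 `^ alpha * T / (2 `^ alpha) ^+ j.
    have -> : (kappa * (2 * z))^-1 / delta = (kappa * 2 * c0)^-1 * N * z^-1.
      by rewrite /delta; field; rewrite !lt0r_neq0.
    have k2c : 0 <= (kappa * 2 * c0)^-1 by rewrite invr_ge0 !mulr_ge0// ltW.
    have z0' : 0 <= z^-1 by rewrite invr_ge0 ltW.
    by rewrite (powRM _ (mulr_ge0 k2c (ltW N0)) z0') (powRM _ k2c (ltW N0)) zV.
  have e4 : (81 * pi * (2 * z) ^+ 2) ^+ d = (81 * pi * 4) ^+ d * (z ^+ d) ^+ 2.
    by rewrite -exprM mulnC exprM -exprMn; congr (_ ^+ _); ring.
  have e5 : q ^+ j = th ^+ j * z ^+ d / (2 `^ alpha) ^+ j.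
    rewrite /q !exprMn /z [in RHS]exprAC; congr (_ * _).
    exact: exprVn.
  have e6 : (N / z) ^+ d = N ^+ d / z ^+ d by rewrite exprMn exprVn.
  rewrite /A e1 e2 e3 e4 e5 e6 /W.
  have zd0 : z ^+ d != 0 by rewrite expf_neq0// lt0r_neq0.
  have ad0 : (2 `^ alpha) ^+ j != 0 :> R by rewrite expf_neq0// lt0r_neq0// powR_gt0.
  move: zd0 ad0; set zd := z ^+ d; set ad := (2 `^ alpha) ^+ j; set w := (_ * 4) ^+ d.
  set thj := th ^+ j; set k2 := _ `^ alpha; set Nd := N ^+ d => zd0 ad0; field.
  by rewrite zd0 ad0.
(* The sum of the series is at most a constant times T^2 N^d, to be divided by a constant times
   N^(2d - 1); as T = N^alpha and d = n + 1, the exponent is 2 alpha - n. *)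
have XK : X <= K1 * N `^ (2 * alpha - n%:R).
  have sT : (size P)%:R <= W2 * T by exact: sizeP.
  have : X * (delta * (N / 2) ^+ 2 ^+ d) <= W * (W2 * T) * T * N ^+ d * (1 - q)^-1.
    move: main; rewrite NE => /le_trans; apply.
    rewrite (eq_bigr (fun j : 'I_J.+1 => W * (size P)%:R * T * N ^+ d * q ^+ j)); last first.
      by move=> j _; apply: term; rewrite -ltnS.
    have N0' := exprn_ge0 d (ltW N0); have T0' := ltW T0.
    rewrite -mulr_sumr; apply: ler_pM; last exact: geometric_le.
    - exact: mulr_ge0 (mulr_ge0 (mulr_ge0 W0 (ler0n _ _)) T0') N0'.
    - by apply: sumr_ge0 => j _; exact: exprn_ge0.
    - by rewrite ler_wpM2r// ler_wpM2r// ler_wpM2l.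
  have dN0 : 0 < delta * (N / 2) ^+ 2 ^+ d by rewrite mulr_gt0// !exprn_gt0// divr_gt0.
  rewrite -ler_pdivlMr// => /le_trans; apply.
  have -> : N `^ (2 * alpha - n%:R) = T ^+ 2 / N ^+ n.
    rewrite powRB; last by apply/implyP => _; rewrite lt0r_neq0.
    by rewrite (mulrC 2) powRrM (powR_mulrn 2 (powR_ge0 _ _)) (powR_mulrn n (ltW N0)).
  have e7 : (N / 2) ^+ 2 ^+ d = (N * N ^+ n) ^+ 2 / 4 ^+ d.
    have -> : (N / 2) ^+ 2 = N ^+ 2 / 4 by field.
    by rewrite -exprS exprMn [4^-1 ^+ d]exprVn exprAC.
  rewrite e7 exprS /delta /K1.
  have Nn0 : N ^+ n != 0 by rewrite expf_neq0// lt0r_neq0.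
  have f0 : 4 ^+ d != 0 :> R by rewrite expf_neq0.
  move: Nn0 f0; set Nn := N ^+ n; set f := 4 ^+ d => Nn0 f0.
  rewrite le_eqVlt; apply/orP; left; apply/eqP; field.
  by rewrite Nn0 f0 !lt0r_neq0.
pose c := [seq row_mx z.1 z.2 | z <- [seq z <- [seq (p, q') | p <- P, q' <- P] | Q z.1 z.2]].
have sizec : (size c)%:R = X.
  rewrite size_map size_filter -sum1_count natr_sum big_mkcond/= big_allpairs.
  by apply: eq_bigr => p _; apply: eq_bigr => q' _ /=; case: (Q p q').
apply: (@le_trans _ _ (size c)%:R%:E); last first.
  rewrite lee_fin sizec; apply: le_trans XK _.
  by rewrite ler_wpM2r ?powR_ge0// lerDl.
apply: ereal_inf_lbound; exists c => //.
move=> v [[x x'] /= [Ex Ex' s01 Hphi] <-].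
have [p pP xp] := Pmax x Ex; have [p' pP' xp'] := Pmax x' Ex'.
exists (row_mx p p').
  apply/mapP; exists (p, p') => //; rewrite mem_filter /=; apply/andP; split; last first.
    by apply/allpairsP; exists (p, p').
  have [s s1 Hs] := configuration_coord Ex Ex' s01 Hphi.
  apply/asboolP; exists s => // i; rewrite -Hs.
  have := xp i; have := xp' i; rewrite !ltr_norml ler_norml; lra.
have -> : (n + d).+2%:R * c0 / N = (n + d).+2%:R * delta by rewrite mulrA.
(* [(n + d).+1] is the dimension 2 d of the space of pairs; the radius has one unit more because
   [eball] is open. *)
apply: (@le_lt_trans _ _ ((n + d).+1%:R * delta)); last by rewrite ltr_pM2r// ltr_nat.
apply: (@edist_le R (n + d)) => [|i]; first exact: ltW.
by rewrite !mxE; case: (@splitP d d i) => k _; rewrite distrC ltW.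
Qed.

End Covering.

(* The ambient dimension is d = n.+1, so that 1 <= n means d >= 2. *)
Theorem corollary1p6 (R : realType) (n : nat) (hn : (1 <= n)%N)
  (gamma : 'I_n -> R -> R)
  (gamma_smooth : forall l : 'I_n, smooth01 (gamma l))
  (gamma_nondeg : nondegenerate_curve (curve_param gamma))
  (E : set 'rV[R]_n.+1)
  (E_compact : compact E)
  (E_regular : ahlfors_david_regular E)
  (E_dim : ((n.+1%:R - n.+1%:R^-1)%:E < hausdorff_dim E)%E)
  (t : 'rV[R]_n) :
  (upper_minkowski_dim (configuration_set gamma E t)
     <= 2%:E * hausdorff_dim E - n%:R%:E)%E.
Proof.
have [mu [alpha [C [dimE _ C0 AD]]]] := E_regular.
move: E_dim; rewrite dimE lte_fin => alpha_gt.
have [K [c [K0 c0 cover]]] :=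
  configuration_cover gamma_smooth gamma_nondeg E_compact C0 AD alpha_gt t.
(* A nonnegative exponent makes the power monotone in its base; here alpha > d - 1/d >= d - 1 =
   n. *)
have b0 : 0 <= 2 * alpha - n%:R.
  have : n%:R <= alpha.
    apply: le_trans (ltW alpha_gt); rewrite -natr1 -addrA lerDl subr_ge0.
    by rewrite invf_le1 ?natr1 ?ler1n ?ltr0n.
  by have := ler0n R n; lra.
rewrite -EFinM -EFinB.
apply: (@upper_minkowski_dim_le _ _ _ (K * (2 * c) `^ (2 * alpha - n%:R)) _ c) => //.
  by rewrite mulr_gt0// powR_gt0// mulr_gt0.
move=> r /andP[r0 rc].
have exJ : exists J : nat, c / 2 ^+ J <= r.
  exists (Num.truncn (c / r)).+1; rewrite ler_pdivrMr ?exprn_gt0// mulrC -ler_pdivrMr//.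
  apply: le_trans (ltW (truncnS_gt (c / r))) _.
  by rewrite -natrX ler_nat ltnW// ltn_expl.
(* Passage from dyadic to arbitrary radii: minimality of [J] gives 2^J <= 2 c / r, and [r < c]
   excludes [J = 0]. *)
have [J cJ Jmin] := ex_minnP exJ.
have J2 : 2 ^+ J <= 2 * c * r^-1.
  case: J cJ Jmin => [|J] cJ Jmin; first by move: cJ; rewrite expr0 divr1; lra.
  rewrite exprS -mulrA ler_wpM2l// ler_pdivlMr// mulrC -ler_pdivlMr ?exprn_gt0//.
  rewrite leNgt; apply/negP => /ltW/Jmin.
  by rewrite ltnn.
apply: le_trans (covering_number_antitone _ cJ) _; apply: le_trans (cover J) _.
rewrite lee_fin -mulrA ler_wpM2l ?(ltW K0)// -powRM ?invr_ge0 ?(ltW r0) ?mulr_ge0 ?(ltW c0)//.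
rewrite ge0_ler_powR// nnegrE ?exprn_ge0// !mulr_ge0 ?invr_ge0 ?(ltW r0) ?(ltW c0)//.
Qed.
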